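(* Let $\alpha>0$. For $n\ge 1$ observe $X^{(n)}$ from the Gaussian white noise model $dX^{(n)}(t)=f(t)\,dt+n^{-1/2}\,dW(t)$, $t\in[0,1]$, with $W$ standard Brownian motion. Suppose the true $f_0$ belongs to the Besov space $B^\alpha_{\infty,\infty}[0,1]$, i.e. $\sup_{l\ge0,0\le k\le2^l-1}2^{l(1/2+\alpha)}|\langle f_0,\psi_{lk}\rangle_2|<\infty$. Let $\varphi$ be a continuous probability density on $\mathbb{R}$, strictly positive on $[-1,1]$, such that there exist $b_1,b_2,c_1,c_2,\delta>0$ with $$c_1e^{-b_1|x|^{1+\delta}}\le\varphi(x)\le c_2e^{-b_2|x|^{1+\delta}}\quad\text{for all }|x|\ge1.$$ Let the prior $\Pi$ on $f$ make the coefficients $f_{lk}=\langle f,\psi_{lk}\rangle_2$ independent, $f_{lk}$ having Lebesgue density $x\mapsto\sigma_l^{-1}\varphi(x/\sigma_l)$ on $\mathbb{R}$, where $$\sigma_l=\frac{2^{-l(1/2+\alpha)}}{(l+1)^{\mu}},\qquad \mu=\frac1{1+\delta}.$$ Then there exists $M>0$ such that for all $n\ge2$, $$E_{f_0}^n\int\|f-f_0\|_\infty\,d\Pi(f\mid X^{(n)})\le M\Big(\frac{\log n}{n}\Big)^{\alpha/(2\alpha+1)}.$$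
   Context: $\{\psi_{lk}: l\ge0,\ 0\le k\le 2^l-1\}$ is the boundary-corrected wavelet basis of $L^2[0,1]$ of Cohen–Daubechies–Vial (relabelled so that levels start at $l=0$), chosen sufficiently regular: orthonormal basis of $L^2[0,1]$; supports of diameter $\lesssim2^{-l}$; $\|\psi_{lk}\|_\infty\lesssim2^{l/2}$; $\|\sum_k|\psi_{lk}|\|_\infty\lesssim2^{l/2}$; $\psi_{lk}$ Hölder of order $S\ge\alpha$; the basis characterises $B^s_{\infty,\infty}[0,1]$, $s\le\alpha$, via the norm $\sup_{l,k}2^{l(1/2+s)}|\langle g,\psi_{lk}\rangle_2|$. Projecting onto the basis, the model is equivalent to observing $x_{lk}=f_{lk}+n^{-1/2}\varepsilon_{lk}$ with i.i.d. $N(0,1)$ errors. $\Pi(\cdot\mid X^{(n)})$ is the posterior, $E^n_{f_0}$ expectation when $f=f_0$. *)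

(* Defs.v *)
From HB Require Import structures.
From mathcomp Require Import all_boot all_order all_algebra.
From mathcomp Require Import all_classical all_reals all_analysis ess_sup_inf.
Set Implicit Arguments. Unset Strict Implicit. Unset Printing Implicit Defensive.
Import Order.TTheory GRing.Theory Num.Theory numFieldNormedType.Exports.
Local Open Scope classical_set_scope.
Local Open Scope ring_scope.

Section defs.
Variable R : realType.

Definition leb := (@lebesgue_measure R).
Definition I01 : set R := `[0%R, 1%R].
Lemma I01_meas : measurable I01. Proof. exact: measurable_itv. Qed.
Definition leb01 := mrestr leb I01_meas.

Definition ip01 (g h : R -> R) : R := Rintegral leb I01 (fun t => g t * h t).

Definition L2_01 (g : R -> R) : Prop :=
  measurable_fun I01 g /\ leb.-integrable I01 (fun t => (g t ^+ 2)%:E).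

Definition supnorm01 (g : R -> R) : \bar R :=
  ess_sup leb01 (fun t => (`|g t|)%:E).

(* Standing assumptions on the (relabelled) boundary-corrected CDV wavelet
   basis {psi l k : l >= 0, 0 <= k <= 2^l - 1} of L^2[0,1], regularity alpha. *)
Definition wavelet_basis (alpha : R) (psi : nat -> nat -> R -> R) : Prop :=
  (forall l k, measurable_fun setT (psi l k)) /\
  (forall l k l' k', (k < 2 ^ l)%N -> (k' < 2 ^ l')%N ->
     ip01 (psi l k) (psi l' k') = if (l == l') && (k == k') then 1 else 0) /\
  (forall g, L2_01 g -> (forall l k, (k < 2 ^ l)%N -> ip01 g (psi l k) = 0) ->
     Rintegral leb I01 (fun t => g t ^+ 2) = 0) /\
  (exists C, 0 < C /\ forall l k, (k < 2 ^ l)%N -> forall s t, s \in I01 -> t \in I01 ->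
     psi l k s != 0 -> psi l k t != 0 -> `|s - t| <= C * (2 ^- l)) /\
  (exists C, 0 < C /\ forall l k t, (k < 2 ^ l)%N -> t \in I01 ->
     `|psi l k t| <= C * Num.sqrt (2 ^+ l)) /\
  (exists C, 0 < C /\ forall l t, t \in I01 ->
     \sum_(k < 2 ^ l) `|psi l k t| <= C * Num.sqrt (2 ^+ l)) /\
  (* Hoelder regularity: implied by "Hoelder of order S >= alpha" *)
  (forall l k, (k < 2 ^ l)%N -> exists K, forall s t, s \in I01 -> t \in I01 ->
     `|psi l k s - psi l k t| <= K * (`|s - t| `^ (Num.min alpha 1))).

Definition besov_inf (alpha : R) (psi : nat -> nat -> R -> R) (f0 : R -> R) : Prop :=
  L2_01 f0 /\
  exists B, forall l k, (k < 2 ^ l)%N ->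
    2 `^ (l%:R * (2^-1 + alpha)) * `|ip01 f0 (psi l k)| <= B.

Definition sigma_l (alpha delta : R) (l : nat) : R :=
  2 `^ (- (l%:R * (2^-1 + alpha))) / (l.+1)%:R `^ ((1 + delta)^-1).

Definition scaled_density (phi : R -> R) (sigma : R) (x : R) : R :=
  sigma^-1 * phi (x / sigma).

(* Gaussian likelihood of one coordinate in the sequence model
   x = theta + n^{-1/2} eps, up to a theta-free factor *)
Definition lik (n : nat) (x theta : R) : R := expR (- (n%:R * (x - theta) ^+ 2) / 2).

Definition post_density (n : nat) (prior : R -> R) (x theta : R) : R :=
  prior theta * lik n x theta / Rintegral leb setT (fun u => prior u * lik n x u).

(* Joint density of (x_lk, theta_lk) under E^n_{f0} x Pi(. | X):
   x_lk ~ N(f0_lk, 1/n) and theta_lk | x_lk ~ posterior *)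
Definition joint_density (n : nat) (f0lk : R) (prior : R -> R) (z : R * R) : R :=
  normal_pdf f0lk (Num.sqrt n%:R)^-1 z.1 * post_density n prior z.1 z.2.

Definition wavelet_series (psi : nat -> nat -> R -> R) (theta : nat -> nat -> R) (t : R) : R :=
  limn (fun L : nat => \sum_(l < L) \sum_(k < 2 ^ l) theta l k * psi l k t).

Definition rate (alpha : R) (n : nat) : R :=
  (ln n%:R / n%:R) `^ (alpha / (2 * alpha + 1)).

Definition indep_pairs d (Omega : measurableType d) (P : probability Omega R)
    (Z : nat -> nat -> Omega -> R * R) : Prop :=
  forall (J : seq (nat * nat)) (B : nat * nat -> set (R * R)),
    uniq J -> (forall j, j \in J -> (j.2 < 2 ^ j.1)%N) ->
    (forall j, measurable (B j)) ->
    P (\bigcap_(j in [set` J]) (Z j.1 j.2 @^-1` B j)) =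
    (\prod_(j <- J) P (Z j.1 j.2 @^-1` B j))%E.

End defs.

(* Main.v *)
Require Import Defs.
From HB Require Import structures.
From mathcomp Require Import all_boot all_order all_algebra.
From mathcomp Require Import all_classical all_reals all_analysis ess_sup_inf.
From mathcomp Require Import measurable_realfun.
From mathcomp Require Import ring lra.
Import Order.TTheory GRing.Theory Num.Theory numFieldNormedType.Exports.
Local Open Scope classical_set_scope.
Local Open Scope ring_scope.
Set Implicit Arguments. Unset Strict Implicit. Unset Printing Implicit Defensive.

(* Only the marginal law of each pair (X_lk, Theta_lk) matters: the sup-norm is at most
   a multiple of the sum over l of 2^(l/2) max_k |Theta_lk - f0_lk|, and for any
   threshold a_l the maximum is at most a_l + sum_k (|Theta_lk - f0_lk| - a_l)_+.
   Restricting the normalising integral of the posterior to a neighbourhood of f0_lk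
   of radius sigma_l / sqrt n shows that the joint density of (x, th) is at most
   C sqrt n e^(C l) times prior(th) times the N(th, 1/n) density of x.
   When 2^l > (n / ln n)^(1/(2 alpha + 1)) the factor sqrt n e^(C l) is e^(O(l)), which
   the prior tail e^(- b A^(1 + delta) (l + 1)) beyond a_l = A 2^(-l (1/2 + alpha)) absorbs.
   At lower levels the factor is polynomial in n, and a Gaussian weight obtained by AM-GM
   absorbs it beyond a_l = A sqrt (ln n / n).  Two geometric sums then give the rate. *)

(** The exponent mu = 1/(1+delta) balances the two tail bounds on phi. Relative to sigma_l, both the
    size allowed for f0_lk and the high-level threshold a_l are of order (l+1)^mu. The lower tail
    bound therefore costs e^(C l) in the normalising integral, while the upper one gains e^(- C' l).
    Here C depends only on the bound for f0 and on phi, and C' grows with A, so a large A wins. The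
    obstacle is that the normalising integral is a data-dependent denominator. Its lower bound
    carries the likelihood at f0_lk, which cancels the true density of x up to constants and leaves
    the joint law of a Bayesian model whose parameter is drawn from the prior. At low levels the
    prior alone does not concentrate at scale sqrt (ln n / n), so the data must be used, and the
    polynomial factor must not multiply the contribution of typical data. The AM-GM split achieves
    this: one half is bounded crudely, the other depends on x alone and is integrated under its
    exact law N(f0_lk, 1/n). *)

(** * Monotonicity of integrals and transfer of laws *)

Section integral_comparison.
Local Open Scope ereal_scope.
Context d (T : measurableType d) (R : realType) (mu : {measure set T -> \bar R}).

(** The integral of a nonnegative function is a supremum over simple functions below it, hence
    monotone without measurability, and the negative part of [f] only lowers the left side. This
    serves for the sup-norm loss, whose measurability in the sample point is not established. *)
Lemma le_integral_nomeas (D : set T) (f g : T -> \bar R) :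
  (forall x, D x -> 0 <= g x) -> (forall x, D x -> f x <= g x) ->
  \int[mu]_(x in D) f x <= \int[mu]_(x in D) g x.
Proof.
move=> g0 fg; rewrite integralE.
apply: (@le_trans _ _ (\int[mu]_(x in D) f^\+ x)).
  rewrite -[leRHS]adde0 leeD2l// oppe_le0.
  by apply: integral_ge0 => x _; exact: funeneg_ge0.
have h0 x : 0 <= (f^\+ \_ D) x by apply: erestrict_ge0 => ? _; exact: funepos_ge0.
have k0 x : 0 <= (g \_ D) x by exact: erestrict_ge0.
rewrite (integral_mkcond D f^\+) (integral_mkcond D g) !ge0_integralTE//.
apply: ereal_sup_le => _ [h hf <-]; exists h => // x; apply: (le_trans (hf x)).
rewrite !patchE; case: ifPn => // /set_mem Dx.
by rewrite funeposE ge_max fg//= g0.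
Qed.

Import HBNNSimple.

(** The bound on sets extends to simple functions by linearity, then to [h] by monotone convergence
    on the left and by domination of the approximants by [h] on the right. *)
Lemma ge0_le_integral_density d' (S : measurableType d')
    (nu : {measure set S -> \bar R}) (Z : T -> S) (g h : S -> \bar R) :
  measurable_fun setT Z -> measurable_fun setT g -> measurable_fun setT h ->
  (forall z, 0 <= g z) -> (forall z, 0 <= h z) ->
  (forall B, measurable B -> mu (Z @^-1` B) <= \int[nu]_(z in B) g z) ->
  \int[mu]_w h (Z w) <= \int[nu]_z (h z * g z).
Proof.
move=> mZ mg mh g0 h0 muZ.
pose s := nnsfun_approx measurableT mh.
have sh z : EFin \o s ^~ z @ \oo --> h z by apply: cvg_nnsfun_approx.
have nds z : {homo (fun n => (s n z)%:E) : m n / (m <= n)%N >-> m <= n}.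
  by move=> m n mn; rewrite lee_fin; exact/lefP/nd_nnsfun_approx.
have -> : \int[mu]_w h (Z w) = limn (fun n => \int[mu]_w (s n (Z w))%:E).
  rewrite -monotone_convergence//.
  - by apply: eq_integral => w _; apply/esym/cvg_lim => //; exact: sh.
  - by move=> n; apply/measurable_EFinP; exact: measurableT_comp.
  - by move=> n w _; rewrite lee_fin.
have cs : cvgn (fun n => \int[mu]_w (s n (Z w))%:E).
  apply: ereal_nondecreasing_is_cvgn => m n mn; apply: ge0_le_integral => //.
  - by move=> w _; rewrite lee_fin.
  - by apply/measurable_EFinP; exact: measurableT_comp.
  - by apply/measurable_EFinP; exact: measurableT_comp.
  - by move=> w _; exact: nds.
apply: lime_le => //; apply: nearW => n.
apply: (@le_trans _ _ (\int[nu]_z ((s n z)%:E * g z))); last first.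
  apply: ge0_le_integral => //.
  - by move=> z _; rewrite mule_ge0// lee_fin.
  - by apply: emeasurable_funM => //; exact/measurable_EFinP.
  - exact: emeasurable_funM.
  - move=> z _; rewrite lee_wpmul2r//.
    rewrite -(cvg_lim _ (sh z))//.
    apply: lime_ge; first by apply/cvg_ex; exists (h z); exact: sh.
    by near=> m; apply: nds; near: m; exists n.
have mI r : measurable_fun setT (fun z => (r * \1_(s n @^-1` [set r]) z)%:E).
  by apply/measurable_EFinP; exact: measurable_funM.
under eq_integral do rewrite fimfunE -fsumEFin//.
rewrite ge0_integral_fsum//; last 2 first.
- by move=> r; exact: (measurableT_comp (mI r)).
- by move=> r w _; exact: nnfun_muleindic_ge0.
under [leRHS]eq_integral => z _.
  rewrite fimfunE -fsumEFin// ge0_mule_fsuml; last first.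
    by move=> r; exact: nnfun_muleindic_ge0.
  over.
rewrite ge0_integral_fsum//; last 2 first.
- by move=> r; exact: emeasurable_funM.
- by move=> r z _; rewrite mule_ge0// nnfun_muleindic_ge0.
rewrite !fsbig_finite//; apply: lee_sum => r _.
have [r0|r0] := ltP r 0%R.
  rewrite preimage_nnfun0// indic0.
  by rewrite !integral0_eq// => z _; rewrite /= mulr0 ?mul0e.
have mB : measurable (s n @^-1` [set r]) by exact: measurable_funPTI.
under eq_integral do rewrite EFinM.
rewrite ge0_integralZl_EFin//; last first.
  by apply/measurable_EFinP; apply: measurableT_comp.
under [leRHS]eq_integral do rewrite EFinM -muleA.
rewrite ge0_integralZl_EFin//; last 2 first.
- by move=> w _; rewrite mule_ge0// lee_fin.
- by apply: emeasurable_funM => //; exact/measurable_EFinP.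
apply: lee_wpmul2l; first by rewrite lee_fin.
have -> : \int[nu]_x ((\1_(s n @^-1` [set r]) x)%:E * g x)
    = \int[nu]_(x in s n @^-1` [set r]) g x.
  rewrite [RHS]integral_mkcond; apply: eq_integral => x _.
  by rewrite epatch_indic muleC.
apply: le_trans (muZ _ mB).
have -> : \int[mu]_x (\1_(s n @^-1` [set r]) (Z x))%:E
    = \int[mu]_x (\1_(Z @^-1` (s n @^-1` [set r])) x)%:E by [].
by rewrite integral_indic// ?setIT// -[X in measurable X]setTI; exact: mZ.
Unshelve. all: by end_near. Qed.
End integral_comparison.

(** * The Gaussian likelihood of one coordinate *)

Section likelihood.
Variables (R : realType) (n : nat).
Implicit Types x th : R.

Lemma lik_ge0 x th : 0 <= lik n x th. Proof. exact: expR_ge0. Qed.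

Lemma lik_le1 x th : lik n x th <= 1.
Proof. by rewrite -expR0 ler_expR mulNr oppr_le0 divr_ge0// mulr_ge0// sqr_ge0. Qed.

Lemma measurable_lik : measurable_fun setT (fun z : R * R => lik n z.1 z.2).
Proof.
apply: measurableT_comp => //; apply: measurable_funM => //.
apply: measurableT_comp => //; apply: measurable_funM => //.
by apply: measurable_funX; apply: measurable_funB.
Qed.

Lemma normal_pdf_lik th x : (0 < n)%N ->
  normal_pdf th (Num.sqrt n%:R)^-1 x = normal_peak (Num.sqrt n%:R)^-1 * lik n x th.
Proof.
move=> n0; have n0R : 0 < n%:R :> R by rewrite ltr0n.
rewrite normal_pdfE ?invr_eq0 ?gt_eqF ?sqrtr_gt0//; congr (_ * expR _).
by rewrite exprVn sqr_sqrtr ?ler0n//; field; rewrite gt_eqF.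
Qed.

End likelihood.

(** * Normalising integral and joint density of one coordinate *)

Section posterior.
Variables (R : realType) (n : nat) (th0 : R) (prior : R -> R).
Hypotheses (n0 : (0 < n)%N) (mprior : measurable_fun setT prior).
Hypotheses (prior0 : forall x, 0 <= prior x).
Hypothesis prior1 : (\int[@leb R]_x (prior x)%:E = 1)%E.
Variables rho p0 : R.
Hypotheses (rho0 : 0 < rho) (p00 : 0 < p0) (nrho : n%:R * rho ^+ 2 <= 1).
Hypothesis prior_lb : forall th, `|th - th0| <= rho -> p0 <= prior th.

Let s : R := (Num.sqrt n%:R)^-1.
Let evid x := Rintegral (@leb R) setT (fun u => prior u * lik n x u).

Let n0R : 0 < n%:R :> R. Proof. by rewrite ltr0n. Qed.
Let s0 : s != 0. Proof. by rewrite invr_eq0 gt_eqF// sqrtr_gt0. Qed.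

Let mpl : measurable_fun setT (fun z : R * R => prior z.2 * lik n z.1 z.2).
Proof. by apply: measurable_funM; [exact: measurableT_comp | exact: measurable_lik]. Qed.

Let mplx x : measurable_fun setT (fun u => prior u * lik n x u).
Proof.
apply: measurable_funM => //.
exact: (measurableT_comp (@measurable_lik R n) (pair1_measurable x)).
Qed.

(** [Rintegral] returns 0 on an infinite integral; this is excluded because the likelihood is at
    most 1 and the prior has mass 1. *)
Lemma evidenceE x : (evid x)%:E = (\int[@leb R]_u (prior u * lik n x u)%:E)%E.
Proof.
rewrite /evid /Rintegral fineK// ge0_fin_numE; last first.
  by apply: integral_ge0 => u _; rewrite lee_fin mulr_ge0// lik_ge0.
apply: (@le_lt_trans _ _ 1%E); last exact: ltry.
rewrite -prior1; apply: le_integral_nomeas => u _; first by rewrite lee_fin.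
by rewrite lee_fin ler_piMr// lik_le1.
Qed.

Lemma evidence_lb x : rho * p0 * expR (- 2^-1) * lik n x th0 <= evid x.
Proof.
rewrite -lee_fin evidenceE.
(* Only the half of the neighbourhood on the same side of [th0] as [x] is used. There the cross term
   of the expanded square is favourable, so moving from [th0] to [th] costs at most exp(- n rho^2 /
   2) >= exp(- 1/2), uniformly in [x]. *)
have key (a : R) : (forall th, a <= th <= a + rho ->
      `|th - th0| <= rho /\ (x - th0) * (th - th0) >= 0) ->
    ((rho * p0 * expR (- 2^-1) * lik n x th0)%:E <=
       \int[@leb R]_u (prior u * lik n x u)%:E)%E.
  move=> ath; apply: (@le_trans _ _
      (\int[@leb R]_(u in `[a, (a + rho)%R]) (prior u * lik n x u)%:E)%E); last first.
    apply: ge0_subset_integral => //.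
    - by apply/measurable_EFinP; exact: mplx.
    - by move=> u _; rewrite lee_fin mulr_ge0// lik_ge0.
  apply: (@le_trans _ _ (\int[@leb R]_(u in `[a, (a + rho)%R])
      (cst (p0 * expR (- 2^-1) * lik n x th0)%:E u))%E).
    rewrite integral_cst//= /leb lebesgue_measure_itv/= lte_fin ltrDl rho0.
    by rewrite -EFinD -EFinM lee_fin addrAC subrr add0r; lra.
  apply: le_integral_nomeas => u.
    by move=> _; rewrite lee_fin mulr_ge0// lik_ge0.
   rewrite /= in_itv/= => /ath[u1 u2].
  rewrite lee_fin -mulrA; apply: ler_pM; [exact: ltW | | exact: prior_lb |].
    by rewrite mulr_ge0 ?expR_ge0.
  rewrite /lik -expRD ler_expR.
  have : (u - th0) ^+ 2 <= rho ^+ 2 by rewrite -[leLHS]real_normK ?num_real// lerXn2r ?nnegrE// ltW.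
  move=> /(ler_wpM2l (ltW n0R)).
  have : 0 <= n%:R * ((x - th0) * (u - th0)) by rewrite mulr_ge0.
  have -> : (x - u) ^+ 2 =
      (x - th0) ^+ 2 - 2 * ((x - th0) * (u - th0)) + (u - th0) ^+ 2 by ring.
  by move: nrho; lra.
have [x0|x0] := leP th0 x.
- apply: (key th0) => th /andP[h1 h2]; split; first by rewrite ger0_norm; lra.
  by rewrite mulr_ge0// subr_ge0.
- apply: (key (th0 - rho)) => th /andP[h1 h2]; split; first by rewrite ler0_norm; lra.
  by rewrite -mulrNN mulr_ge0// oppr_ge0; lra.
Qed.

Lemma evidence_gt0 x : 0 < evid x.
Proof.
by apply: lt_le_trans (evidence_lb x); rewrite !mulr_gt0// expR_gt0.
Qed.

Lemma measurable_evidence : measurable_fun setT evid.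
Proof.
apply/measurable_EFinP.
rewrite (_ : EFin \o evid =
  fubini_F (@leb R) (fun z : R * R => (prior z.2 * lik n z.1 z.2)%:E)); last first.
  by apply/funext => x; rewrite /= evidenceE.
apply: measurable_fun_fubini_tonelli_F.
- by apply/measurable_EFinP; exact: mpl.
- by move=> z; rewrite lee_fin mulr_ge0// lik_ge0.
Qed.

Lemma joint_densityE z : joint_density n th0 prior z =
  normal_pdf th0 s z.1 * (prior z.2 * lik n z.1 z.2 / evid z.1).
Proof. by []. Qed.

Lemma joint_density_ge0 z : 0 <= joint_density n th0 prior z.
Proof.
rewrite joint_densityE mulr_ge0 ?normal_pdf_ge0// divr_ge0//.
  by rewrite mulr_ge0// lik_ge0.
exact/ltW/evidence_gt0.
Qed.

Lemma measurable_joint_density : measurable_fun setT (joint_density n th0 prior).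
Proof.
apply: measurable_funM.
  exact: (measurableT_comp (measurable_normal_pdf _ _)).
apply: measurable_funM => //.
(* The evidence is positive, so its inverse is exp(- ln), a composition of measurable functions. *)
rewrite (_ : (fun z => _) = fun z : R * R => expR (- ln (evid z.1))); last first.
  by apply/funext => z; rewrite expRN lnK// posrE; exact: evidence_gt0.
apply: measurableT_comp => //; apply: measurableT_comp => //.
apply: measurableT_comp => //.
exact: (measurableT_comp measurable_evidence).
Qed.

(** The factor [lik n x th0] in the data density cancels the same factor in [evidence_lb]. What
    remains is the joint density of a parameter drawn from the prior and its noisy observation. *)
Lemma joint_density_ub z : joint_density n th0 prior z <=
  expR (2^-1) / (rho * p0) * (prior z.2 * normal_pdf z.2 s z.1).
Proof.
rewrite joint_densityE !normal_pdf_lik//.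
have e0 := evidence_gt0 z.1.
have pk := @normal_peak_ge0 R s.
rewrite [leLHS]mulrA ler_pdivrMr//.
have -> : normal_peak s * lik n z.1 th0 * (prior z.2 * lik n z.1 z.2) =
  expR (2^-1) / (rho * p0) * (prior z.2 * (normal_peak s * lik n z.1 z.2)) *
   (rho * p0 * expR (- 2^-1) * lik n z.1 th0).
  rewrite expRN; field.
  by rewrite !gt_eqF// expR_gt0.
apply: ler_wpM2l; last exact: evidence_lb.
by rewrite !mulr_ge0// ?expR_ge0// invr_ge0 mulr_ge0// ltW.
Qed.

(** For each [x] the posterior density has mass 1, so functions of [x] alone are integrated exactly,
    without the factor of [joint_density_ub]. *)
Lemma integral_joint_marginal (h : R -> R) : measurable_fun setT h ->
  (forall x, 0 <= h x) ->
  (\int[(@leb R \x @leb R)%E]_z (h z.1 * joint_density n th0 prior z)%:E =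
   \int[@leb R]_x (h x * normal_pdf th0 s x)%:E)%E.
Proof.
move=> mh h0; rewrite fubini_tonelli1/=; last 2 first.
- apply/measurable_EFinP; apply: measurable_funM; last exact: measurable_joint_density.
  exact: measurableT_comp.
- by move=> z; rewrite lee_fin mulr_ge0// joint_density_ge0.
apply: eq_integral => x _; rewrite /fubini_F/=.
under eq_integral => u _.
  rewrite joint_densityE/= [X in X%:E](_ : _ =
    h x * normal_pdf th0 s x / evid x * (prior u * lik n x u)); last by ring.
  rewrite EFinM; over.
rewrite ge0_integralZl_EFin//.
- by rewrite -evidenceE -EFinM divfK// gt_eqF// evidence_gt0.
- by move=> u _; rewrite lee_fin mulr_ge0// lik_ge0.
- by apply/measurable_EFinP; exact: mplx.
- by rewrite divr_ge0 ?mulr_ge0 ?normal_pdf_ge0// ltW// evidence_gt0.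
Qed.

End posterior.

(** * Gaussian mixtures *)

Section normal_mixture.
Variable R : realType.
Implicit Types (s m x : R) (g : R -> R).

Lemma measurable_normal_pdf_pair s : s != 0 ->
  measurable_fun setT (fun z : R * R => normal_pdf z.2 s z.1).
Proof.
move=> s0; rewrite (_ : (fun _ => _) = fun z : R * R =>
  normal_peak s * expR (- (z.1 - z.2) ^+ 2 / (s ^+ 2 *+ 2))); last first.
  by apply/funext => z; rewrite normal_pdfE.
apply: measurable_funM => //; apply: measurableT_comp => //.
apply: measurable_funM => //; apply: measurableT_comp => //.
by apply: measurable_funX; apply: measurable_funB.
Qed.

Lemma integral_normal_mixture s g : s != 0 -> measurable_fun setT g ->
  (forall x, 0 <= g x) ->
  (\int[(@leb R \x @leb R)%E]_z (g z.2 * normal_pdf z.2 s z.1)%:E =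
   \int[@leb R]_x (g x)%:E)%E.
Proof.
move=> s0 mg g0; rewrite fubini_tonelli2/=; last 2 first.
- apply/measurable_EFinP; apply: measurable_funM.
    exact: measurableT_comp.
  exact: measurable_normal_pdf_pair.
- by move=> z; rewrite lee_fin mulr_ge0// normal_pdf_ge0.
apply: eq_integral => y _; rewrite /fubini_G/=.
under eq_integral do rewrite EFinM.
rewrite ge0_integralZl_EFin//.
- by rewrite integral_normal_pdf mule1.
- by move=> u _; rewrite lee_fin normal_pdf_ge0.
- by apply/measurable_EFinP; exact: measurable_normal_pdf.
Qed.

Lemma normal_peak_sqrt2 s : s != 0 ->
  normal_peak s = Num.sqrt 2 * normal_peak (Num.sqrt 2 * s).
Proof.
move=> s0; rewrite /normal_peak exprMn sqr_sqrtr//.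
rewrite (_ : 2 * s ^+ 2 * pi *+ 2 = 2 * (s ^+ 2 * pi *+ 2)); last by rewrite mulrnAr mulrA.
rewrite [in RHS]sqrtrM// invfM mulrA divff ?mul1r//.
Qed.

(** Half of the Gaussian exponent is cancelled, which doubles the variance; the factor sqrt 2
    corrects the peak. *)
Lemma normal_pdf_widen (n : nat) m x : (0 < n)%N ->
  normal_pdf m (Num.sqrt n%:R)^-1 x * expR (n%:R * (x - m) ^+ 2 / 4) =
  Num.sqrt 2 * normal_pdf m (Num.sqrt 2 * (Num.sqrt n%:R)^-1) x.
Proof.
move=> n0; have n0R : 0 < n%:R :> R by rewrite ltr0n.
have s0 : (Num.sqrt n%:R)^-1 != 0 :> R by rewrite invr_eq0 gt_eqF// sqrtr_gt0.
have s2 : Num.sqrt 2 * (Num.sqrt n%:R)^-1 != 0 :> R.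
  by rewrite mulf_neq0// gt_eqF// sqrtr_gt0.
rewrite !normal_pdfE// normal_peak_sqrt2// -!mulrA; congr (_ * (_ * _)).
rewrite /normal_fun -expRD; congr expR.
rewrite exprMn !sqr_sqrtr// exprVn sqr_sqrtr ?ler0n//.
by field; rewrite gt_eqF.
Qed.

End normal_mixture.

(** * Two bounds on posterior moments of one coordinate *)

Section posterior_moments.
Variables (R : realType) (n : nat) (th0 : R) (prior : R -> R).
Hypotheses (n0 : (0 < n)%N) (mprior : measurable_fun setT prior).
Hypotheses (prior0 : forall x, 0 <= prior x).
Hypothesis prior1 : (\int[@leb R]_x (prior x)%:E = 1)%E.
Variables rho p0 : R.
Hypotheses (rho0 : 0 < rho) (p00 : 0 < p0) (nrho : n%:R * rho ^+ 2 <= 1).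
Hypothesis prior_lb : forall th, `|th - th0| <= rho -> p0 <= prior th.
Variable h : R -> R.
Hypotheses (mh : measurable_fun setT h) (h0 : forall x, 0 <= h x).

Let s : R := (Num.sqrt n%:R)^-1.
Let n0R : 0 < n%:R :> R. Proof. by rewrite ltr0n. Qed.
Let s0 : s != 0. Proof. by rewrite invr_eq0 gt_eqF// sqrtr_gt0. Qed.
Let K := expR (2^-1) / (rho * p0).
Let K0 : 0 <= K. Proof. by rewrite divr_ge0 ?expR_ge0// mulr_ge0// ltW. Qed.

Let jub := @joint_density_ub R n th0 prior n0 mprior prior0 prior1 rho p0
  rho0 p00 nrho prior_lb.
Let j0 := @joint_density_ge0 R n th0 prior n0 mprior prior0 prior1 rho p0
  rho0 p00 nrho prior_lb.
Let mj := @measurable_joint_density R n th0 prior n0 mprior prior0 prior1 rho p0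
  rho0 p00 nrho prior_lb.

(** This bound discards the information in the data and suits levels where the prior tail alone is
    small enough. *)
Lemma posterior_moment_prior :
  (\int[(@leb R \x @leb R)%E]_z (h z.2 * joint_density n th0 prior z)%:E <=
   K%:E * \int[@leb R]_x (h x * prior x)%:E)%E.
Proof.
have mhp : measurable_fun setT (fun x => h x * prior x) by exact: measurable_funM.
rewrite -ge0_integralZl_EFin//; last 2 first.
- by move=> x _; rewrite lee_fin mulr_ge0.
- by apply/measurable_EFinP; exact: mhp.
rewrite -(@integral_normal_mixture R s (fun x => K * (h x * prior x)))//; last 2 first.
- by apply: measurable_funM => //; exact: measurable_cst.
- by move=> x; rewrite mulr_ge0// mulr_ge0.
apply: le_integral_nomeas => z _; rewrite lee_fin.
  by rewrite mulr_ge0 ?normal_pdf_ge0// mulr_ge0// mulr_ge0.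
apply: (le_trans (ler_wpM2l (h0 _) (jub z))).
by rewrite -/K -/s le_eqVlt; apply/orP; left; apply/eqP; ring.
Qed.

(* With e = sqrt n (x - th0), AM-GM splits h into lam h^2 exp(-e^2/4), where the
   Gaussian weight compensates for the crude bound on the joint density, and
   exp(e^2/4)/lam, which only involves the exact Gaussian law of x. *)
Lemma posterior_moment_gauss (lam c : R) : 0 < lam ->
  (forall th, h th ^+ 2 * expR (- (n%:R * (th - th0) ^+ 2 / 8)) <= c) ->
  (\int[(@leb R \x @leb R)%E]_z (h z.2 * joint_density n th0 prior z)%:E <=
   (lam * K * c + lam^-1)%:E)%E.
Proof.
move=> lam0 hc.
pose q (x : R) := n%:R * (x - th0) ^+ 2 / 4.
have c0 : 0 <= c by apply: le_trans (hc 0); rewrite mulr_ge0 ?sqr_ge0 ?expR_ge0.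
have sq2 : Num.sqrt 2 <= 2 :> R.
  by rewrite -[leRHS]ger0_norm// -sqrtr_sqr ler_sqrt//; lra.
pose A (z : R * R) := lam * K * c * (prior z.2 * normal_pdf z.2 (Num.sqrt 2 * s) z.1).
pose B (z : R * R) := (lam^-1 / 2) * expR (q z.1) * joint_density n th0 prior z.
have s20 : Num.sqrt 2 * s != 0 by rewrite mulf_neq0// gt_eqF// sqrtr_gt0.
have mq : measurable_fun setT q.
  apply: measurable_funM => //; apply: measurable_funM => //.
  by apply: measurable_funX; apply: measurable_funB.
have mA : measurable_fun setT A.
  apply: measurable_funM => //; apply: measurable_funM.
    exact: measurableT_comp.
  exact: measurable_normal_pdf_pair.
have mB : measurable_fun setT B.
  apply: measurable_funM; last exact: mj.
  by apply: measurable_funM => //; apply: measurableT_comp => //;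
    exact: measurableT_comp.
have lKc : 0 <= lam * K * c by rewrite mulr_ge0// mulr_ge0// ltW.
have A0 z : 0 <= A z by rewrite mulr_ge0// mulr_ge0// normal_pdf_ge0.
have il : 0 <= lam^-1 / 2 by rewrite divr_ge0// invr_ge0 ltW.
have B0 z : 0 <= B z by rewrite mulr_ge0// mulr_ge0// expR_ge0.
apply: (@le_trans _ _ (\int[(@leb R \x @leb R)%E]_z ((A z)%:E + (B z)%:E))%E).
  apply: le_integral_nomeas => z _; first by rewrite adde_ge0// lee_fin.
  rewrite -EFinD lee_fin.
  have e0 : 0 < expR (q z.1) by exact: expR_gt0.
  have amgm : h z.2 <= lam / 2 * (h z.2 ^+ 2 * expR (- q z.1)) + lam^-1 / 2 * expR (q z.1).
    rewrite -subr_ge0 expRN [X in 0 <= X](_ : _ =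
      (lam * h z.2 - expR (q z.1)) ^+ 2 / (2 * lam * expR (q z.1))).
      by rewrite divr_ge0 ?sqr_ge0// !mulr_ge0// ltW.
    by field; rewrite !gt_eqF.
  apply: (le_trans (ler_wpM2r (j0 z) amgm)).
  rewrite mulrDl lerD// /A.
  apply: (@le_trans _ _ (lam / 2 * (h z.2 ^+ 2 * expR (- q z.1)) *
      (K * (prior z.2 * normal_pdf z.2 s z.1)))).
    by apply: ler_wpM2l (jub z); rewrite !mulr_ge0 ?sqr_ge0 ?expR_ge0// ltW.
  (* From (th - th0)^2 <= 2 (x - th0)^2 + 2 (x - th)^2 the Gaussian weight passes from [x] to [th].
     The price exp(n (x - th)^2 / 4) is paid by widening the density of [x] given [th]. *)
  have qe : expR (- q z.1) <= expR (- (n%:R * (z.2 - th0) ^+ 2 / 8)) *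
      expR (n%:R * (z.1 - z.2) ^+ 2 / 4).
    rewrite -expRD ler_expR /q.
    have : 0 <= n%:R * ((z.1 - th0) + (z.1 - z.2)) ^+ 2 by rewrite mulr_ge0// sqr_ge0.
    by lra.
  apply: (@le_trans _ _ (lam / 2 * (h z.2 ^+ 2 *
       (expR (- (n%:R * (z.2 - th0) ^+ 2 / 8)) * expR (n%:R * (z.1 - z.2) ^+ 2 / 4))) *
      (K * (prior z.2 * normal_pdf z.2 s z.1)))).
    apply: ler_wpM2r; first by rewrite mulr_ge0// mulr_ge0// normal_pdf_ge0.
    apply: ler_wpM2l; first by rewrite mulr_ge0// ltW.
    by apply: ler_wpM2l; first exact: sqr_ge0.
  rewrite [leLHS](_ : _ = h z.2 ^+ 2 * expR (- (n%:R * (z.2 - th0) ^+ 2 / 8)) *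
     (lam / 2 * K * prior z.2 * (normal_pdf z.2 s z.1 *
        expR (n%:R * (z.1 - z.2) ^+ 2 / 4)))); last by ring.
  rewrite normal_pdf_widen//.
  apply: (@le_trans _ _ (c * (lam / 2 * K * prior z.2 * (2 *
      normal_pdf z.2 (Num.sqrt 2 * s) z.1)))).
    apply: ler_pM => //; first by rewrite mulr_ge0 ?sqr_ge0 ?expR_ge0.
      rewrite mulr_ge0//; last by rewrite mulr_ge0// ?normal_pdf_ge0// sqrtr_ge0.
      by rewrite mulr_ge0// mulr_ge0// divr_ge0// ltW.
    apply: ler_wpM2l; first by rewrite mulr_ge0// mulr_ge0// divr_ge0// ltW.
    by apply: ler_wpM2r => //; exact: normal_pdf_ge0.
  by rewrite le_eqVlt; apply/orP; left; apply/eqP; field.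
rewrite ge0_integralD//; last 4 first.
- by move=> z _; rewrite lee_fin.
- by apply/measurable_EFinP; exact: mA.
- by move=> z _; rewrite lee_fin.
- by apply/measurable_EFinP; exact: mB.
rewrite EFinD; apply: leeD.
  have -> : (\int[(@leb R \x @leb R)%E]_z (A z)%:E =
     \int[(@leb R \x @leb R)%E]_z
       ((fun x => lam * K * c * prior x) z.2 *
         normal_pdf z.2 (Num.sqrt 2 * s) z.1)%:E)%E.
    by apply: eq_integral => z _; rewrite /A mulrA.
  rewrite (@integral_normal_mixture R (Num.sqrt 2 * s) (fun x => lam * K * c * prior x))//; last 2 first.
  - by apply: measurable_funM => //; exact: measurable_cst.
  - by move=> x; rewrite mulr_ge0.
  under eq_integral do rewrite EFinM.
  rewrite ge0_integralZl_EFin//.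
  - by rewrite prior1 mule1.
  - by move=> x _; rewrite lee_fin.
  - by apply/measurable_EFinP; exact: mprior.
rewrite /B (@integral_joint_marginal _ _ _ _ n0 mprior prior0 prior1 rho p0
  rho0 p00 nrho prior_lb (fun x => lam^-1 / 2 * expR (q x)))//; last 2 first.
- by apply: measurable_funM => //; exact: measurableT_comp.
- by move=> x; rewrite mulr_ge0 ?expR_ge0.
under eq_integral => x _.
  rewrite [X in X%:E](_ : _ = lam^-1 / 2 * Num.sqrt 2 *
    normal_pdf th0 (Num.sqrt 2 * s) x); last first.
    by rewrite -[RHS]mulrA -normal_pdf_widen// /q; ring.
  rewrite EFinM; over.
rewrite ge0_integralZl_EFin//.
- rewrite integral_normal_pdf mule1 lee_fin.
  rewrite (_ : lam^-1 / 2 * Num.sqrt 2 = lam^-1 * (Num.sqrt 2 / 2)); last by ring.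
  by apply: ler_piMr; [rewrite invr_ge0 ltW | rewrite ler_pdivrMr// mul1r].
- by move=> x _; rewrite lee_fin normal_pdf_ge0.
- by apply/measurable_EFinP; exact: measurable_normal_pdf.
- by rewrite mulr_ge0 ?sqrtr_ge0.
Qed.

End posterior_moments.

(** * Rescaling and an exponential integral *)

Section scaling.
Variable R : realType.

(** Total mass is not fixed to 1, so that the lemma serves both for the prior and for the
    exponential majorant in [post_excess_high]. *)
Lemma integral_scaled_density (g : R -> R) (s : R) : 0 < s -> continuous g ->
  (forall x, 0 <= g x) ->
  (\int[@leb R]_x (scaled_density g s x)%:E = \int[@leb R]_x (g x)%:E)%E.
Proof.
move=> s0 cg g0; pose F (x : R^o) : R^o := x / s.
have F'E : F^`()%classic = cst s^-1.
  apply/funext => x; rewrite /F derive1E deriveM// derive_cst scaler0 add0r.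
  by rewrite derive_id scaler1.
rewrite /leb (@increasing_ge0_integration_by_substitutionT _ F g)//.
- apply: eq_integral => x _; rewrite F'E /scaled_density/=.
  by rewrite !fctE/= mulrC.
- by move=> x y xy; rewrite /F ltr_pM2r// invr_gt0.
- by rewrite F'E => ?; exact: cvg_cst.
- by rewrite F'E; exact: is_cvg_cst.
- by rewrite F'E; exact: is_cvg_cst.
- by apply/gt0_cvgMlNy; [rewrite invr_gt0 | exact: cvg_id].
- by apply/gt0_cvgMly; [rewrite invr_gt0 | exact: cvg_id].
Qed.

(** The integrand lies below the sum of the standard exponential density and its reflection, each of
    mass at most 1. *)
Lemma integral_expR_Nnorm : (\int[@leb R]_x (expR (- `|x|))%:E <= 2%:E)%E.
Proof.
pose f (x : R) : \bar R := (exponential_pdf 1 x)%:E.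
have f0 x : (0 <= f x)%E by rewrite lee_fin exponential_pdf_ge0.
have mf : measurable_fun setT f.
  by apply/measurable_EFinP; exact: measurable_exponential_pdf.
have If : (\int[@leb R]_x f x = 1)%E by exact: integral_exponential_pdf.
have IfN : (\int[@leb R]_x f (- x)%R <= 1)%E.
  have -> : (\int[@leb R]_x f (- x)%R = \int[@leb R]_(x in `]-oo, 0%R]) f (- x)%R)%E.
    rewrite [RHS]integral_mkcond; apply: eq_integral => x _.
    rewrite patchE; case: ifPn => //; rewrite notin_setE/= in_itv/= => /negP.
    by rewrite -ltNge => x0; rewrite /f lt0_exponential_pdf// oppr_lt0.
  rewrite /leb -ge0_integration_by_substitution0// -If.
  by apply: ge0_subset_integral.
apply: (@le_trans _ _ (\int[@leb R]_x (f x + f (- x)%R))%E).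
  apply: le_integral_nomeas => x _; first by rewrite adde_ge0.
  have [x0|x0] := leP 0 x.
    rewrite ger0_norm// -[leLHS]adde0 leeD// /f exponential_pdfE//.
    by rewrite mul1r mulN1r.
  rewrite ltr0_norm// -[leLHS]add0e leeD// /f exponential_pdfE//.
    by rewrite mul1r mulN1r.
  by rewrite oppr_ge0 ltW.
rewrite ge0_integralD//; last first.
  exact: (measurableT_comp mf).
by rewrite If (_ : 2 = 1 + 1)// EFinD leeD.
Qed.

End scaling.

(** * Uniform forms of the assumptions on phi *)

Section density.
Variables (R : realType) (phi : R -> R) (delta : R).
Hypotheses (cphi : continuous phi) (delta0 : 0 < delta).
Hypothesis phi_ge0 : forall x, 0 <= phi x.
Hypothesis phi_gt0 : forall x : R, -1 <= x <= 1 -> 0 < phi x.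

(** Compactness gives a positive minimum on [-1,1], the tail condition covers the rest. Stating the
    result in terms of [Y] spares later proofs the distinction between the two regions. *)
Lemma density_lower_bound (b1 c1 : R) : 0 < b1 -> 0 < c1 ->
  (forall x, 1 <= `|x| -> c1 * expR (- b1 * `|x| `^ (1 + delta)) <= phi x) ->
  exists2 c, 0 < c & forall x Y, 1 <= Y -> `|x| <= Y ->
    c * expR (- b1 * Y `^ (1 + delta)) <= phi x.
Proof.
move=> b10 c10 hphi.
have [x0 x0I x0min] := @EVT_min R phi (-1) 1 ltac:(lra) ltac:(exact: continuous_subspaceT).
have p0 : 0 < phi x0 by apply: phi_gt0; move: x0I; rewrite in_itv.
exists (Num.min c1 (phi x0)); first by rewrite lt_min c10.
move=> x Y Y1 xY.
have [x1|x1] := leP 1 `|x|.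
  apply: le_trans (hphi x x1).
  apply: ler_pM; rewrite ?expR_ge0 ?le_min ?(ltW c10) ?(ltW p0)//.
    by rewrite ge_min lexx.
  rewrite ler_expR !mulNr lerN2; apply: ler_wpM2l; first exact: ltW.
  by rewrite ge0_ler_powR// ?nnegrE ?addr_ge0 ?ltW// (lt_le_trans ltr01).
apply: (@le_trans _ _ (phi x0)); last first.
  by apply: x0min; rewrite in_itv/=; move: x1; rewrite ltr_norml => /andP[? ?]; rewrite !ltW.
apply: (@le_trans _ _ (Num.min c1 (phi x0))); last by rewrite ge_min lexx orbT.
apply: ler_piMr; first by rewrite le_min !ltW.
by rewrite -expR0 ler_expR mulNr oppr_le0 mulr_ge0 ?powR_ge0// ltW.
Qed.

Lemma density_tail_bound (b2 c2 : R) : 0 < b2 -> 0 < c2 ->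
  (forall x, 1 <= `|x| -> phi x <= c2 * expR (- b2 * `|x| `^ (1 + delta))) ->
  exists2 C, 0 < C & forall x Y, 1 <= Y -> Y <= `|x| ->
    `|x| * phi x <= C * expR (- (b2 / 2) * Y `^ (1 + delta)) * expR (- `|x|).
Proof.
move=> b20 c20 hphi.
(* Beyond [y0], half of the exponent, (b2/2) y^(1+delta), exceeds 2y. One y pays for |x| <= e^|x|,
   the other creates the integrable factor e^(-|x|). The constant e^(2 y0) covers smaller y. *)
pose y0 := (4 / b2) `^ delta^-1.
exists (c2 * expR (2 * y0)); first by rewrite mulr_gt0// expR_gt0.
move=> x Y Y1 Yx; set y := `|x| in Yx *.
have y1 : 1 <= y by exact: le_trans Yx.
have y00 : 0 < y by exact: lt_le_trans y1.
apply: (@le_trans _ _ (expR y * (c2 * expR (- b2 * y `^ (1 + delta))))).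
  apply: ler_pM; rewrite ?normr_ge0//; last exact: hphi.
  by apply: le_trans (expR_ge1Dx _); rewrite lerDr.
rewrite mulrCA -[leRHS]mulrA -[leRHS]mulrA ler_pM2l// -!expRD ler_expR.
set P := y `^ _; set Q := Y `^ _.
have QP : Q <= P.
  by rewrite ge0_ler_powR// ?nnegrE ?addr_ge0// ?ltW// (lt_le_trans ltr01).
have P0 : 0 <= P by exact: powR_ge0.
have y00' : 0 <= y0 by exact: powR_ge0.
have bQP := ler_wpM2l (ltW b20) QP.
have bP0 := mulr_ge0 (ltW b20) P0.
suff : 2 * y <= 2 * y0 + b2 / 2 * P by lra.
have [yy0|yy0] := leP y y0; first by lra.
have : 4 / b2 <= y `^ delta.
  have -> : 4 / b2 = y0 `^ delta.
    rewrite /y0 -powRrM mulVf ?gt_eqF// powRr1//.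
    by apply: divr_ge0 => //; exact: ltW.
  by apply: ge0_ler_powR; rewrite ?nnegrE// ltW.
move=> /(ler_wpM2l (ltW y00)).
have -> : y * y `^ delta = P.
  rewrite /P powRD; last by apply/implyP => _; rewrite gt_eqF.
  by rewrite powRr1// ltW.
move=> h.
have := ler_wpM2l (ltW b20) h.
rewrite (_ : b2 * (y * (4 / b2)) = 4 * y); first by lra.
by field; rewrite gt_eqF.
Qed.

End density.

(** * Posterior excess of one coefficient over a threshold *)

Definition excess (R : realType) (a th0 th : R) : R := Num.max (`|th - th0| - a) 0.

(** The coefficient size permitted by the Besov condition: [sigma_l] without its factor
    (l+1)^(-mu). *)
Definition coef_scale (R : realType) (alpha : R) (l : nat) : R :=
  2 `^ (- (l%:R * (2^-1 + alpha))).

Section excess.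
Variable R : realType.

Lemma excess_ge0 (a th0 th : R) : 0 <= excess a th0 th.
Proof. by rewrite le_max lexx orbT. Qed.

Lemma measurable_excess (a th0 : R) : measurable_fun setT (excess a th0).
Proof.
apply: measurable_maxr => //; apply: measurable_funB => //.
by apply: measurableT_comp => //; exact: measurable_funB.
Qed.

Lemma le_excess (a th0 th : R) : `|th - th0| <= a + excess a th0 th.
Proof. by rewrite -lerBlDl le_max lexx. Qed.

End excess.

Section coefficient.
Variables (R : realType) (alpha delta : R) (phi : R -> R).
Variables (b1 c b C B : R).
Hypotheses (alpha0 : 0 < alpha) (delta0 : 0 < delta).
Hypotheses (cphi : continuous phi) (phi0 : forall x, 0 <= phi x).
Hypothesis phi1 : (\int[@leb R]_x (phi x)%:E = 1)%E.
Hypotheses (b10 : 0 < b1) (c0 : 0 < c) (b0 : 0 < b) (C0 : 0 < C) (B0 : 0 <= B).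
Hypothesis phi_lb : forall x Y, 1 <= Y -> `|x| <= Y ->
  c * expR (- b1 * Y `^ (1 + delta)) <= phi x.
Hypothesis phi_ub : forall x Y, 1 <= Y -> Y <= `|x| ->
  `|x| * phi x <= C * expR (- b * Y `^ (1 + delta)) * expR (- `|x|).

Let tau := coef_scale alpha.
Let sigma := sigma_l alpha delta.
Let mu := (1 + delta)^-1.
Let E := b1 * (B + 1) `^ (1 + delta).

Let d1 : 0 < 1 + delta. Proof. by rewrite addr_gt0. Qed.

Let lmu (l : nat) : 1 <= (l.+1)%:R `^ mu :> R.
Proof.
apply: (@le_trans _ _ (1 `^ mu)); first by rewrite powR1.
by rewrite ge0_ler_powR ?nnegrE ?ler1n// invr_ge0 ltW.
Qed.

Let tau_gt0 l : 0 < tau l. Proof. by rewrite powR_gt0. Qed.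

Let sigma_gt0 l : 0 < sigma l.
Proof. by rewrite divr_gt0// ?powR_gt0. Qed.

Let tauE l : tau l = sigma l * (l.+1)%:R `^ mu.
Proof. by rewrite /sigma /sigma_l divfK// gt_eqF// (lt_le_trans ltr01). Qed.

Let sigma_le_tau l : sigma l <= tau l.
Proof. by rewrite tauE ler_pMr. Qed.

Let sigma_le1 l : sigma l <= 1.
Proof.
apply: (le_trans (sigma_le_tau l)).
rewrite -(@powRr0 R 2) ler_powR// ?ler1n// oppr_le0 mulr_ge0//.
by rewrite addr_ge0// ltW.
Qed.

(** The choice of mu acts here: raising to the power 1+delta turns the factor (l+1)^mu into l+1, so
    tail exponents become linear in the level. *)
Let powY (l : nat) (A : R) : 0 <= A ->
  (A * (l.+1)%:R `^ mu) `^ (1 + delta) = A `^ (1 + delta) * (l.+1)%:R.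
Proof.
by move=> A0; rewrite powRM ?powR_ge0// -powRrM mulVf ?gt_eqF// powRr1.
Qed.

(** The radius is at most [tau l], hence |th| <= (B + 1) tau_l throughout the neighbourhood, and
    this is (B + 1) (l+1)^mu in units of [sigma l]. *)
Let priorlb n l th0 th : (0 < n)%N -> `|th0| <= B * tau l ->
  `|th - th0| <= sigma l / Num.sqrt n%:R ->
  (sigma l)^-1 * (c * expR (- (E * (l.+1)%:R))) <= scaled_density phi (sigma l) th.
Proof.
move=> n0 th0B thth0; have s0 := sigma_gt0 l.
rewrite /scaled_density ler_pM2l ?invr_gt0//.
have -> : - (E * (l.+1)%:R) = - b1 * ((B + 1) * (l.+1)%:R `^ mu) `^ (1 + delta).
  by rewrite powY ?addr_ge0// /E mulNr mulrA.
apply: phi_lb.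
  by apply: (le_trans (lmu l)); rewrite ler_peMl ?powR_ge0// lerDr.
rewrite normrM normfV (gtr0_norm s0) ler_pdivrMr//.
have : `|th - th0| <= sigma l.
  apply: (le_trans thth0); apply: ler_piMr; first exact: ltW.
  rewrite invf_le1; last first.
    by rewrite sqrtr_gt0 ltr0n.
  apply: (@le_trans _ _ (Num.sqrt 1)); first by rewrite sqrtr1.
  by apply: ler_wsqrtr; rewrite ler1n.
have := ler_normD (th - th0) th0; rewrite subrK => h1 h2.
apply: (le_trans h1); rewrite addrC -mulrA [X in _ * X]mulrC -tauE mulrDl mul1r.
by apply: lerD => //; exact: le_trans (sigma_le_tau l).
Qed.

Definition post_excess n l th0 a : \bar R :=
  (\int[(@leb R \x @leb R)%E]_z
     (excess a th0 z.2 * joint_density n th0 (scaled_density phi (sigma l)) z)%:E)%E.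

Let mprior l : measurable_fun setT (scaled_density phi (sigma l)).
Proof.
apply: measurable_funM => //.
apply: (measurableT_comp (continuous_measurable_fun cphi)).
exact: measurable_funM.
Qed.

Let prior0 l x : 0 <= scaled_density phi (sigma l) x.
Proof. by rewrite mulr_ge0// invr_ge0 ltW. Qed.

Let prior1 l : (\int[@leb R]_x (scaled_density phi (sigma l) x)%:E = 1)%E.
Proof. by rewrite integral_scaled_density. Qed.

(** Taking the radius proportional to [sigma l] cancels the height 1/sigma_l of the prior, so no
    power of [sigma l] survives. *)
Let KE n l : (0 < n)%N ->
  expR 2^-1 / (sigma l / Num.sqrt n%:R * ((sigma l)^-1 * (c * expR (- (E * (l.+1)%:R)))))
  = expR 2^-1 / c * Num.sqrt n%:R * expR (E * (l.+1)%:R).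
Proof.
move=> n0; rewrite expRN; field.
by rewrite !gt_eqF// ?expR_gt0// sqrtr_gt0 ltr0n.
Qed.

Let rho0 n l : (0 < n)%N -> 0 < sigma l / Num.sqrt n%:R.
Proof. by move=> n0; rewrite divr_gt0// sqrtr_gt0 ltr0n. Qed.

Let p00 l : 0 < (sigma l)^-1 * (c * expR (- (E * (l.+1)%:R))).
Proof. by rewrite mulr_gt0 ?invr_gt0// mulr_gt0// expR_gt0. Qed.

Let nrho n l : (0 < n)%N -> n%:R * (sigma l / Num.sqrt n%:R) ^+ 2 <= 1.
Proof.
move=> n0; rewrite exprMn exprVn sqr_sqrtr ?ler0n// mulrCA divff ?mulr1.
  by rewrite expr_le1// ltW.
by rewrite gt_eqF// ltr0n.
Qed.

(** Since |th0| <= B tau_l, a positive excess forces |th| >= A tau_l, that is |th / sigma_l| >= A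
    (l+1)^mu, and is itself at most |th|. The prior tail then suffices. *)
Lemma post_excess_high n l th0 (A : R) : (0 < n)%N -> `|th0| <= B * tau l -> 1 <= A ->
  (post_excess n l th0 ((B + A) * tau l) <=
   (expR 2^-1 / c * Num.sqrt n%:R * expR (E * (l.+1)%:R) *
    (2 * C * sigma l * expR (- (b * A * (l.+1)%:R))))%:E)%E.
Proof.
move=> n0 th0B A1; have s0 := sigma_gt0 l.
have A0 : 0 <= A by exact: le_trans A1.
set a := (B + A) * tau l.
apply: (@le_trans _ _ _ _ _ (@posterior_moment_prior R n th0 _ n0 (mprior l)
  (prior0 l) (prior1 l) _ _ (rho0 l n0) (p00 l) (nrho l n0)
  (fun th => @priorlb n l th0 th n0 th0B) _ (measurable_excess a th0)
  (excess_ge0 a th0))).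
rewrite KE// [leRHS]EFinM; apply: lee_wpmul2l.
  by rewrite lee_fin !mulr_ge0 ?expR_ge0// ?invr_ge0 ?ltW// sqrtr_ge0.
(* Majorant in the variable y = th / sigma_l; its leading factor [sigma l] comes from |th| = sigma_l
   |y|. *)
pose g (y : R) := sigma l * (C * expR (- (b * A * (l.+1)%:R))) * expR (- `|y|).
have g0 y : 0 <= g y by rewrite !mulr_ge0 ?expR_ge0// ltW.
have cg : continuous g.
  move=> y; apply: cvgM; first exact: cvg_cst.
  apply: (cvg_comp _ expR); last exact: continuous_expR.
  by apply: cvgN; exact: norm_continuous.
apply: (@le_trans _ _ (\int[@leb R]_x (scaled_density g (sigma l) x)%:E)%E).
  apply: le_integral_nomeas => th _; rewrite lee_fin.
    by rewrite mulr_ge0// invr_ge0 ltW.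
  have [tha|tha] := leP (`|th - th0| - a) 0.
    by rewrite /excess max_r// mul0r mulr_ge0// invr_ge0 ltW.
  have a0 : 0 <= a by rewrite mulr_ge0 ?addr_ge0// ltW.
  have th1 : `|th - th0| <= `|th| + B * tau l.
    by apply: (le_trans (ler_normB _ _)); rewrite lerD2l.
  have thA : A * tau l <= `|th| by move: tha; rewrite /a; lra.
  have ex : excess a th0 th <= `|th|.
    rewrite /excess max_l; last exact: ltW.
    by have := mulr_ge0 A0 (ltW (tau_gt0 l)); rewrite /a; lra.
  pose Y := A * (l.+1)%:R `^ mu.
  have Y1 : 1 <= Y by rewrite -[leLHS]mulr1 ler_pM.
  have thE : `|th / sigma l| = `|th| / sigma l.
    by rewrite normrM normfV (gtr0_norm s0).
  have YY : Y <= `|th / sigma l|.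
    by rewrite thE ler_pdivlMr// /Y -mulrA [X in A * X]mulrC -tauE.
  apply: (@le_trans _ _ (`|th / sigma l| * phi (th / sigma l))).
    rewrite /scaled_density thE mulrA; apply: ler_wpM2r => //.
    by apply: ler_wpM2r => //; rewrite invr_ge0 ltW.
  apply: (le_trans (phi_ub Y1 YY)).
  rewrite /scaled_density /g -[sigma l * _ * _]mulrA mulKf ?gt_eqF//.
  apply: ler_wpM2r; first exact: expR_ge0.
  apply: ler_wpM2l; first exact: ltW.
  rewrite ler_expR mulNr lerN2 /Y powY// -mulrA; apply: ler_wpM2l; first exact: ltW.
  apply: ler_wpM2r => //.
  (* A >= 1 gives A <= A^(1+delta); an exponent linear in A lets A be solved for explicitly
     later. *)
  rewrite -[leLHS]powRr1//; apply: ler_powR => //.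
  by rewrite lerDl ltW.
rewrite integral_scaled_density//.
under eq_integral do rewrite EFinM.
rewrite ge0_integralZl_EFin//; last 2 first.
- apply/measurable_EFinP; apply: measurableT_comp => //.
  exact: measurableT_comp.
- by rewrite !mulr_ge0 ?expR_ge0// ltW.
apply: (le_trans (lee_wpmul2l _ (@integral_expR_Nnorm R))).
  by rewrite lee_fin !mulr_ge0 ?expR_ge0// ltW.
by rewrite -EFinM lee_fin le_eqVlt; apply/orP; left; apply/eqP; ring.
Qed.

(** Where the excess is positive, v = |th - th0| >= a. The weight exp(- n v^2 / 8) is split in two:
    one half absorbs v^2 <= (16/n) exp(n v^2 / 16), the other is at most exp(- n a^2 / 16). *)
Lemma post_excess_low n l th0 (a lam : R) : (0 < n)%N -> `|th0| <= B * tau l ->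
  0 <= a -> 0 < lam ->
  (post_excess n l th0 a <=
   (lam * (expR 2^-1 / c * Num.sqrt n%:R * expR (E * (l.+1)%:R)) *
    (16 / n%:R * expR (- (n%:R * a ^+ 2 / 16))) + lam^-1)%:E)%E.
Proof.
move=> n0 th0B a0 lam0; have N0 : 0 < n%:R :> R by rewrite ltr0n.
rewrite -KE//.
apply: (@posterior_moment_gauss R n th0 _ n0 (mprior l)
  (prior0 l) (prior1 l) _ _ (rho0 l n0) (p00 l) (nrho l n0)
  (fun th => @priorlb n l th0 th n0 th0B) _ (excess_ge0 a th0)) => // th.
have [tha|tha] := leP (`|th - th0| - a) 0.
  by rewrite /excess max_r// expr0n mul0r mulr_ge0 ?expR_ge0.
have ex : excess a th0 th ^+ 2 <= (th - th0) ^+ 2.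
  rewrite -[leRHS]real_normK ?num_real// lerXn2r ?nnegrE ?excess_ge0//.
  by rewrite /excess max_l ?gerBl//; exact: ltW.
have av : a ^+ 2 <= (th - th0) ^+ 2.
  rewrite -[leRHS]real_normK ?num_real// lerXn2r ?nnegrE//.
  by move: tha; rewrite subr_gt0 => /ltW.
set v2 := (th - th0) ^+ 2 in ex av *.
have v20 : 0 <= v2 by exact: sqr_ge0.
have ve : v2 <= 16 / n%:R * expR (n%:R * v2 / 16).
  rewrite mulrAC ler_pdivlMr// mulrC.
  have := expR_ge1Dx (n%:R * v2 / 16); lra.
apply: (@le_trans _ _ (16 / n%:R * expR (n%:R * v2 / 16) * expR (- (n%:R * v2 / 8)))).
  by apply: ler_wpM2r; [exact: expR_ge0 | exact: le_trans ve].
rewrite -mulrA -expRD ler_pM2l ?divr_gt0// ler_expR.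
have := ler_wpM2l (ltW N0) av; lra.
Qed.

Lemma integral_excess_le n l th0 (a : R) d (Omega : measurableType d)
    (P : probability Omega R) (X Th : Omega -> R) :
  (0 < n)%N -> `|th0| <= B * tau l ->
  measurable_fun setT X -> measurable_fun setT Th ->
  (forall A : set (R * R), measurable A ->
     P ((fun w => (X w, Th w)) @^-1` A) =
     (\int[(@leb R \x @leb R)%E]_(z in A)
        (joint_density n th0 (scaled_density phi (sigma l)) z)%:E)%E) ->
  (\int[P]_w (excess a th0 (Th w))%:E <= post_excess n l th0 a)%E.
Proof.
move=> n0 th0B mX mTh law.
have mj := @measurable_joint_density R n th0 _ n0 (mprior l)
  (prior0 l) (prior1 l) _ _ (rho0 l n0) (p00 l) (nrho l n0)
  (fun th => @priorlb n l th0 th n0 th0B).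
have j0 := @joint_density_ge0 R n th0 _ n0 (mprior l)
  (prior0 l) (prior1 l) _ _ (rho0 l n0) (p00 l) (nrho l n0)
  (fun th => @priorlb n l th0 th n0 th0B).
have := @ge0_le_integral_density _ Omega R P _ _ (@leb R \x @leb R)%E
  (fun w => (X w, Th w))
  (fun z => (joint_density n th0 (scaled_density phi (sigma l)) z)%:E)
  (fun z => (excess a th0 z.2)%:E).
apply.
- exact: measurable_fun_pair.
- by apply/measurable_EFinP; exact: mj.
- apply/measurable_EFinP.
  by apply: (measurableT_comp (measurable_excess a th0)); exact: measurable_snd.
- by move=> z; rewrite lee_fin.
- by move=> z; rewrite lee_fin excess_ge0.
- by move=> A mA; rewrite le_eqVlt; apply/orP; left; apply/eqP; exact: law.
Qed.

End coefficient.

(** * The cutoff between noise and smoothness *)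

Section level_bound.
Variables (R : realType) (alpha : R).
Hypothesis alpha0 : 0 < alpha.

(* The noise dominates at the levels with 2 ^ l <= cutoff n, the smoothness of
   f0 at the others. *)
Definition cutoff (n : nat) : R := (ln n%:R / n%:R) `^ (- (2 * alpha + 1)^-1).

(** The two branches agree at the crossing, because cutoff^(-(1/2 + alpha)) = sqrt (ln n / n). *)
Definition level_rate (n l : nat) : R :=
  if 2 ^+ l <= cutoff n then Num.sqrt (ln n%:R / n%:R) else coef_scale alpha l.

Lemma ln_ge_half (n : nat) : (2 <= n)%N -> 2^-1 <= ln n%:R :> R.
Proof.
move=> n2; rewrite -ler_expR lnK ?posrE ?ltr0n ?(leq_trans _ n2)//.
apply: (@le_trans _ _ 2); last by rewrite ler_nat.
have := expR_ge1Dx (- 2^-1 : R); rewrite expRN => h.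
rewrite -[leLHS]invrK -[leRHS]invrK lef_pV2 ?posrE ?invr_gt0 ?expR_gt0//.
by apply: le_trans h; lra.
Qed.

Lemma exp2_le_expR (l : nat) : 2 ^+ l <= expR l%:R :> R.
Proof.
rewrite -[l%:R]mulr1 expRM_natl.
rewrite lerXn2r ?nnegrE ?expR_ge0//.
by have := expR_ge1Dx (1 : R); lra.
Qed.

Lemma ln_le_sub1 (x : R) : 0 < x -> ln x <= x - 1.
Proof. by move=> x0; have := expR_ge1Dx (ln x); rewrite lnK ?posrE//; lra. Qed.

(** Above the cutoff n / ln n < 2^(l (2 alpha + 1)), while ln n <= 2 sqrt n gives sqrt n / 2 <= n /
    ln n. Thus the factor sqrt n is exponential in the level. *)
Lemma sqrt_le_above_cutoff (n l : nat) : (2 <= n)%N -> cutoff n < 2 ^+ l ->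
  Num.sqrt n%:R <= 2 * expR ((2 * alpha + 1) * (l.+1)%:R) :> R.
Proof.
move=> n2 cl; have N0 : 0 < n%:R :> R by rewrite ltr0n (leq_trans _ n2).
have L0 : 0 < ln n%:R :> R by exact: lt_le_trans (ln_ge_half n2).
have a1 : 0 < 2 * alpha + 1 by rewrite addr_gt0// mulr_gt0.
pose r := Num.sqrt n%:R : R.
have r0 : 0 < r by rewrite sqrtr_gt0.
have rr : r * r = n%:R by rewrite -expr2 sqr_sqrtr// ltW.
have lnr : ln n%:R <= 2 * r.
  by rewrite -rr lnM ?posrE//; have := ln_le_sub1 r0; lra.
have : cutoff n `^ (2 * alpha + 1) <= expR (l.+1)%:R `^ (2 * alpha + 1).
  apply: ge0_ler_powR; rewrite ?nnegrE ?powR_ge0 ?expR_ge0 ?(ltW a1)//.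
  apply: (le_trans (ltW cl)); apply: (le_trans (exp2_le_expR l)).
  by rewrite ler_expR ler_nat.
rewrite /cutoff -powRrM mulNr mulVf ?gt_eqF// powR_inv1 ?invf_div; last first.
  by rewrite divr_ge0 ?ltW.
rewrite -expRM [(l.+1)%:R * _]mulrC => h.
rewrite -/r -ler_pdivrMl//; apply: le_trans h.
by rewrite ler_pdivlMr//; have := ler_wpM2l (ltW r0) lnr; lra.
Qed.

(** The cutoff is a power at most 1 of n / ln n >= 1, and ln n >= 1/2. Hence e^(C l) is polynomial
    in n at these levels. *)
Lemma below_cutoff (n l : nat) : (2 <= n)%N -> 2 ^+ l <= cutoff n ->
  2 ^+ l <= 2 * n%:R :> R.
Proof.
move=> n2 lc; have N0 : 0 < n%:R :> R by rewrite ltr0n (leq_trans _ n2).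
have L0 := ln_ge_half n2.
have L1 : 0 < ln n%:R :> R by exact: lt_le_trans L0.
have a1 : 0 < 2 * alpha + 1 by rewrite addr_gt0// mulr_gt0.
have q0 : 0 <= ln n%:R / n%:R :> R by rewrite divr_ge0 ?ltW.
apply: (le_trans lc); rewrite /cutoff -mulN1r powRrM powR_inv1// invf_div.
have N1 : 1 <= n%:R / ln n%:R :> R.
  by rewrite ler_pdivlMr// mul1r; have := ln_le_sub1 N0; lra.
apply: (@le_trans _ _ (n%:R / ln n%:R)).
  rewrite -[leRHS]powRr1; last exact: le_trans N1.
  apply: ler_powR => //.
  by rewrite invf_le1// lerDr mulr_ge0// ltW.
by rewrite ler_pdivrMr//; have := ler_wpM2l (ltW N0) L0; lra.
Qed.

End level_bound.

(** * Choice of thresholds at each level *)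

Section level_posterior.
Variables (R : realType) (alpha delta : R) (phi : R -> R).
Variables (b1 c b C B : R).
Hypotheses (alpha0 : 0 < alpha) (delta0 : 0 < delta).
Hypotheses (cphi : continuous phi) (phi0 : forall x, 0 <= phi x).
Hypothesis phi1 : (\int[@leb R]_x (phi x)%:E = 1)%E.
Hypotheses (b10 : 0 < b1) (c0 : 0 < c) (b0 : 0 < b) (C0 : 0 < C) (B0 : 0 <= B).
Hypothesis phi_lb : forall x Y, 1 <= Y -> `|x| <= Y ->
  c * expR (- b1 * Y `^ (1 + delta)) <= phi x.
Hypothesis phi_ub : forall x Y, 1 <= Y -> Y <= `|x| ->
  `|x| * phi x <= C * expR (- b * Y `^ (1 + delta)) * expR (- `|x|).

(** [a] and [e] are chosen before [th0], so one pair serves all coefficients of the level; the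
    factor 2^l accounts for their number. *)
Lemma level_posterior_bound : exists2 M, 0 < M &
  forall n l, (2 <= n)%N -> exists a e, [/\ 0 <= a, 0 <= e,
    forall th0, `|th0| <= B * coef_scale alpha l ->
      (post_excess alpha delta phi n l th0 a <= e%:E)%E &
    a + 2 ^+ l * e <= M * level_rate alpha n l].
Proof.
pose E := b1 * (B + 1) `^ (1 + delta).
have E0 : 0 <= E by rewrite mulr_ge0 ?powR_ge0// ltW.
pose K1 := expR 2^-1 / c.
have K10 : 0 < K1 by rewrite divr_gt0 ?expR_gt0.
(* Chosen so that b A = b + E + (2 alpha + 1) + 1, which absorbs in turn e^(E (l+1)), the bound on
   sqrt n above the cutoff, and 2^l; the surplus b keeps the exponent negative. *)
pose A := 1 + (E + 2 * alpha + 2) / b.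
have A1 : 1 <= A.
  by rewrite lerDl divr_ge0 ?(ltW b0)// !addr_ge0// mulr_ge0// ltW.
(* With a = A' sqrt (ln n / n) this makes exp(- n a^2 / 16) equal to n^(-4 - 2 E): n^(-2 E) offsets
   e^(E (l+1)) up to a constant, and n^(-4) the remaining powers of n. *)
pose A' := 4 * Num.sqrt (4 + 2 * E).
have A'0 : 0 <= A' by rewrite mulr_ge0// sqrtr_ge0.
pose Mh := B + A + 4 * K1 * C.
pose Ml := A' + 4 * (16 * K1 * expR (2 * E) + 1).
have Mh0 : 0 < Mh.
  have : 0 < 4 * K1 * C by rewrite mulr_gt0// mulr_gt0.
  by rewrite /Mh; move: A1 B0; lra.
have eE0 : 0 < 16 * K1 * expR (2 * E).
  by rewrite mulr_gt0 ?expR_gt0// mulr_gt0.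
have Ml0 : 0 < Ml by rewrite /Ml; move: A'0 eE0; lra.
exists (Mh + Ml); first by rewrite addr_gt0.
move=> n l n2; have n0 : (0 < n)%N by exact: leq_trans n2.
have N0 : 0 < n%:R :> R by rewrite ltr0n.
have L0 := @ln_ge_half R n n2.
have L1 : 0 < ln n%:R :> R by exact: lt_le_trans L0.
have q0 : 0 <= ln n%:R / n%:R :> R by rewrite divr_ge0 ?ltW.
have t0 : 0 < coef_scale alpha l by rewrite powR_gt0.
have el (x : R) : 2 ^+ l * expR (x * (l.+1)%:R) <= expR ((x + 1) * (l.+1)%:R).
  rewrite [X in _ <= expR X](_ : _ = (l.+1)%:R + x * (l.+1)%:R); last by ring.
  rewrite expRD ler_pM2r ?expR_gt0//; apply: (le_trans (exp2_le_expR R l)).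
  by rewrite ler_expR ler_nat.
rewrite /level_rate; case: ifPn => [lc|]; last rewrite -ltNge => lc.
  pose N : R := n%:R; pose L : R := ln N.
  have NE : N = expR L by rewrite /L lnK// posrE.
  pose a := A' * Num.sqrt (L / N).
  have a0 : 0 <= a by rewrite mulr_ge0// sqrtr_ge0.
  have a2 : N * a ^+ 2 / 16 = (4 + 2 * E) * L.
    rewrite /a !exprMn !sqr_sqrtr//; last by rewrite addr_ge0// mulr_ge0.
    by field; rewrite gt_eqF.
  (* This is the bound of [post_excess_low] with lam = N^2: both summands are then O(N^(-2)), and at
     most 2 N coefficients leave O(1/N), below sqrt (ln n / n) up to a constant. *)
  pose e := N ^+ 2 * (K1 * Num.sqrt N * expR (E * (l.+1)%:R)) *
    (16 / N * expR (- (N * a ^+ 2 / 16))) + (N ^+ 2)^-1.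
  have N20 : 0 < N ^+ 2 by rewrite exprn_gt0.
  exists a, e; split => //.
  - rewrite addr_ge0 ?invr_ge0 ?(ltW N20)// mulr_ge0//.
      by rewrite mulr_ge0 ?(ltW N20)// mulr_ge0 ?expR_ge0// mulr_ge0 ?sqrtr_ge0 ?ltW.
    by rewrite mulr_ge0 ?expR_ge0// divr_ge0// ltW.
  - by move=> th0 th0B; apply: (post_excess_low (B := B) (b1 := b1)).
  have lN : 2 ^+ l <= 2 * N := below_cutoff alpha0 n2 lc.
  (* Logarithms of 2^l <= 2 N, with ln 2 >= 1/2. *)
  have lL : l%:R <= 1 + 2 * L.
    have := lN; rewrite -ler_ln ?posrE ?exprn_gt0 ?mulr_gt0//.
    rewrite lnM ?posrE// lnXn// -/L => h.
    have l2 : 2^-1 <= ln 2 := @ln_ge_half R 2 isT.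
    have hl : l%:R * ln 2 = ln 2 *+ l :> R by rewrite mulr_natl.
    have [//|h2] := leP (l%:R : R) (1 + 2 * L).
    have l20 : 0 < ln 2 :> R by exact: lt_le_trans l2.
    have h3 : 0 < (l%:R - (1 + 2 * L)) * ln 2 by rewrite mulr_gt0// subr_gt0.
    have h4 : L * 2^-1 <= L * ln 2 by apply: ler_wpM2l => //; exact: ltW.
    by move: h h3 h4; rewrite -hl; lra.
  have sN : Num.sqrt N <= N.
    rewrite -[leRHS]ger0_norm ?(ltW N0)// -sqrtr_sqr ler_wsqrtr//.
    by rewrite expr2 ler_peMl ?(ltW N0)// /N ler1n.
  have eb : e <= (16 * K1 * expR (2 * E) + 1) / N ^+ 2.
    rewrite mulrDl mul1r lerD2r a2.
    apply: (@le_trans _ _ (N ^+ 2 * (K1 * N * expR (2 * E + 2 * E * L)) *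
        (16 / N * expR (- ((4 + 2 * E) * L))))).
      apply: ler_wpM2r.
        by rewrite mulr_ge0 ?expR_ge0// divr_ge0// ltW.
      apply: ler_wpM2l; first exact: ltW.
      apply: ler_pM; [|exact: expR_ge0| |].
      - by rewrite mulr_ge0 ?sqrtr_ge0// ltW.
      - by apply: ler_wpM2l => //; exact: ltW.
      rewrite ler_expR -natr1.
      by have := ler_wpM2l E0 lL; lra.
    have -> : expR (- ((4 + 2 * E) * L)) = expR (- (2 * E * L)) / N ^+ 4.
      rewrite NE -expRM_natl -expRN -expRD; congr expR; ring.
    rewrite expRD expRN le_eqVlt; apply/orP; left; apply/eqP; field.
    by rewrite !gt_eqF// expR_gt0.
  have sL : N^-1 <= 2 * Num.sqrt (L / N).
    have -> : 2 * Num.sqrt (L / N) = Num.sqrt (4 * (L / N)).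
      rewrite [RHS]sqrtrM//; congr (_ * _).
      rewrite (_ : 4 = 2 ^+ 2 :> R); last by ring.
      by rewrite sqrtr_sqr ger0_norm.
    rewrite -[leLHS]ger0_norm ?invr_ge0 ?(ltW N0)// -sqrtr_sqr ler_wsqrtr//.
    rewrite expr2 mulrA ler_pM2r ?invr_gt0//.
    apply: (@le_trans _ _ 1); last by move: L0; rewrite -/N -/L; lra.
    by rewrite invf_le1// /N ler1n.
  pose Q := 16 * K1 * expR (2 * E) + 1.
  have Q0 : 0 < Q by rewrite addr_gt0.
  have : 2 ^+ l * e <= 4 * Q * Num.sqrt (L / N).
    apply: (@le_trans _ _ (2 * N * (Q / N ^+ 2))).
      apply: (@le_trans _ _ (2 ^+ l * (Q / N ^+ 2))).
        by apply: ler_wpM2l eb; exact: exprn_ge0.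
      by apply: ler_wpM2r lN; rewrite divr_ge0 ?exprn_ge0 ?ltW.
    rewrite [leLHS](_ : _ = 2 * Q * N^-1); last by field; rewrite gt_eqF.
    rewrite [leRHS](_ : _ = 2 * Q * (2 * Num.sqrt (L / N))); last by ring.
    by apply: ler_wpM2l => //; rewrite mulr_ge0// ltW.
  have := mulr_ge0 (ltW Mh0) (sqrtr_ge0 (L / N)).
  by rewrite /Ml /a -/Q -/N -/L; lra.
pose e := K1 * Num.sqrt n%:R * expR (E * (l.+1)%:R) *
    (2 * C * sigma_l alpha delta l * expR (- (b * A * (l.+1)%:R))).
have s0 : 0 < sigma_l alpha delta l by rewrite divr_gt0 ?powR_gt0.
have st : sigma_l alpha delta l <= coef_scale alpha l.
  rewrite ler_pdivrMr ?powR_gt0// ler_peMr ?powR_ge0//.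
  rewrite -[leLHS](@powRr0 R (l.+1)%:R); apply: ler_powR; first by rewrite ler1n.
  by rewrite invr_ge0 addr_ge0// ltW.
exists ((B + A) * coef_scale alpha l), e; split.
- by rewrite mulr_ge0 ?(ltW t0)// addr_ge0// (le_trans _ A1).
- rewrite mulr_ge0// mulr_ge0 ?expR_ge0//; first by rewrite mulr_ge0 ?sqrtr_ge0// ltW.
  by rewrite mulr_ge0 ?(ltW s0)// mulr_ge0// ltW.
- by move=> th0 th0B; apply: (post_excess_high (B := B) (b1 := b1)).
have sq := sqrt_le_above_cutoff alpha0 n2 lc.
suff le : 2 ^+ l * e <= 4 * K1 * C * coef_scale alpha l.
  by have := mulr_ge0 (ltW Ml0) (ltW t0); rewrite /Mh; lra.
apply: (@le_trans _ _ (4 * K1 * C * sigma_l alpha delta l)); last first.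
  by apply: ler_wpM2l => //; rewrite mulr_ge0 ?(ltW C0)// mulr_ge0// ltW.
pose m : R := (l.+1)%:R.
have bA : b * A = b + (E + 2 * alpha + 2).
  by rewrite /A; field; rewrite gt_eqF.
rewrite [leLHS](_ : _ = 2 * K1 * C * sigma_l alpha delta l *
  (Num.sqrt n%:R * (2 ^+ l * expR ((E - b * A) * m)))); last first.
  by rewrite mulrBl expRB /e expRN -/m; ring.
rewrite [leRHS](_ : _ = 2 * K1 * C * sigma_l alpha delta l * 2); last by ring.
apply: ler_wpM2l.
  by rewrite mulr_ge0 ?(ltW s0)// mulr_ge0 ?(ltW C0)// mulr_ge0// ltW.
apply: (@le_trans _ _ (2 * expR ((2 * alpha + 1) * m) * expR ((E - b * A + 1) * m))).
  apply: ler_pM; [exact: sqrtr_ge0| |exact: sq|exact: el].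
  by rewrite mulr_ge0 ?expR_ge0// exprn_ge0.
rewrite -mulrA -expRD -mulrDl; apply: ler_piMr => //.
apply: (@le_trans _ _ (expR 0)); last by rewrite expR0.
by rewrite ler_expR mulr_le0_ge0 ?ler0n// bA; move: b0; lra.
Qed.

End level_posterior.

(** * Summation of the level rates *)

Section geometric.
Variable R : realType.

Lemma geometric_sum_below (q S : R) (m : nat) : 1 < q -> 0 <= S ->
  \sum_(l < m) (if q ^+ l <= S then q ^+ l else 0) <= S * q / (q - 1).
Proof.
move=> q1 S0; have q10 : 0 < q - 1 by rewrite subr_gt0.
have q0 : 0 < q by exact: lt_trans q1.
rewrite ler_pdivlMr//.
(* The second bound makes the induction work: a newly kept term raises it to q^(m+1), which is at
   most S q precisely because that term is at most S. *)
suff [//] : (\sum_(l < m) (if q ^+ l <= S then q ^+ l else 0)) * (q - 1) <= S * q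
  /\ (\sum_(l < m) (if q ^+ l <= S then q ^+ l else 0)) * (q - 1) <= q ^+ m.
elim: m => [|m [ih1 ih2]].
  by rewrite big_ord0 mul0r expr0; split => //; rewrite mulr_ge0// ltW.
rewrite big_ord_recr/= mulrDl; case: ifPn => [h|_].
  have : q ^+ m * q <= S * q by rewrite ler_pM2r.
  by rewrite exprSr; split; lra.
rewrite mul0r addr0; split => //.
by apply: (le_trans ih2); rewrite ler_weXn2l// ltW.
Qed.

Lemma geometric_sum_above (r s : R) (m : nat) : 0 <= r -> r < 1 -> 0 <= s ->
  \sum_(l < m) (if r ^+ l < s then r ^+ l else 0) <= s / (1 - r).
Proof.
move=> r0 r1 s0; have r10 : 0 < 1 - r by rewrite subr_gt0.
rewrite ler_pdivlMr//.
(* [Num.min (r ^+ m) s] is a potential: a kept term uses up r^m - r^(m+1) of it, and a discarded one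
   does not increase it. *)
suff : (\sum_(l < m) (if r ^+ l < s then r ^+ l else 0)) * (1 - r) +
    Num.min (r ^+ m) s <= s.
  apply: le_trans; rewrite lerDl le_min s0 andbT; exact: exprn_ge0.
elim: m => [|m ih].
  by rewrite big_ord0 mul0r add0r ge_min lexx orbT.
rewrite big_ord_recr/= mulrDl; move: ih; case: ltP => [h|h] ih.
  apply: le_trans ih; rewrite exprSr.
  have : Num.min (r ^+ m * r) s <= r ^+ m * r by rewrite ge_min lexx.
  by lra.
rewrite mul0r addr0; apply: le_trans ih; rewrite lerD2l.
by rewrite ge_min lexx orbT.
Qed.

Lemma sqrt_exp2 (l : nat) : Num.sqrt (2 ^+ l) = Num.sqrt 2 ^+ l :> R.
Proof. by elim: l => [|l ih]; rewrite ?expr0 ?sqrtr1// !exprS sqrtrM// ih. Qed.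

(** The sup-norm weight 2^(l/2) of a level cancels the 1/2 in the coefficient scale, leaving
    geometric decay. *)
Lemma sqrt_exp2_coef_scale (alpha : R) (l : nat) :
  Num.sqrt (2 ^+ l) * coef_scale alpha l = (2 `^ (- alpha)) ^+ l.
Proof.
rewrite sqrt_exp2.
have -> : Num.sqrt 2 ^+ l = 2 `^ (2^-1 * l%:R) :> R.
  by rewrite -powR_mulrn ?sqrtr_ge0// -powR12_sqrt// -powRrM.
rewrite /coef_scale -powRD; last by apply/implyP => _; rewrite gt_eqF.
by rewrite -powR_mulrn ?powR_ge0// -powRrM; congr powR; field.
Qed.

Lemma powR2N_lt1 (alpha : R) : 0 < alpha -> 2 `^ (- alpha) < 1 :> R.
Proof.
move=> alpha0; rewrite powRN invf_lt1 ?powR_gt0//.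
apply: (@le_lt_trans _ _ (1 `^ alpha)); first by rewrite powR1.
by rewrite gt0_ltr_powR ?nnegrE// ltr1n.
Qed.

Lemma level_rate_sum (alpha : R) : 0 < alpha -> exists2 C, 0 < C &
  forall n m, (2 <= n)%N ->
  \sum_(l < m) Num.sqrt (2 ^+ l) * level_rate alpha n l <= C * rate alpha n.
Proof.
move=> alpha0; pose q : R := Num.sqrt 2; pose r : R := 2 `^ (- alpha).
have a1 : 0 < 2 * alpha + 1 by rewrite addr_gt0// mulr_gt0.
have q1 : 1 < q.
  by apply: (@le_lt_trans _ _ (Num.sqrt 1)); [rewrite sqrtr1 | rewrite ltr_sqrt ?ltr1n].
have q10 : 0 < q - 1 by rewrite subr_gt0.
have r0 : 0 < r by rewrite powR_gt0.
have r1 : r < 1 by exact: powR2N_lt1.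
have r10 : 0 < 1 - r by rewrite subr_gt0.
exists (q / (q - 1) + (1 - r)^-1).
  by rewrite addr_gt0 ?divr_gt0 ?invr_gt0// (lt_trans ltr01).
move=> n m n2; have N0 : 0 < n%:R :> R by rewrite ltr0n (leq_trans _ n2).
have L0 : 0 < ln n%:R :> R by exact: lt_le_trans (ln_ge_half R n2).
pose eps : R := ln n%:R / n%:R.
have e0 : 0 < eps by rewrite divr_gt0.
have T0 : 0 < cutoff alpha n by rewrite powR_gt0.
have ra0 : 0 < rate alpha n by rewrite powR_gt0.
have sqE l : Num.sqrt (2 ^+ l) = q ^+ l :> R by exact: sqrt_exp2.
(* 2^l <= cutoff becomes q^l <= S, so the lower levels sum to a multiple of S sqrt (ln n / n), which
   is the rate. *)
pose S := Num.sqrt (cutoff alpha n).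
have S0 : 0 <= S by exact: sqrtr_ge0.
have Srate : S * Num.sqrt eps = rate alpha n.
  rewrite /S -!powR12_sqrt ?powR_ge0 ?(ltW e0)// /cutoff -powRrM -powRD; last first.
    by apply/implyP => _; rewrite gt_eqF.
  by rewrite /rate; congr powR; field; rewrite gt_eqF.
have rl l : q ^+ l * coef_scale alpha l = r ^+ l by rewrite -sqE sqrt_exp2_coef_scale.
apply: (@le_trans _ _ (\sum_(l < m) (if q ^+ l <= S then q ^+ l else 0) * Num.sqrt eps +
    \sum_(l < m) (if r ^+ l < rate alpha n then r ^+ l else 0))).
  rewrite -big_split/=; apply: ler_sum => l _; rewrite sqE /level_rate.
  case: ifPn => [h|]; last rewrite -ltNge => h.
    rewrite ifT; last by rewrite -sqE ler_wsqrtr.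
    by rewrite lerDl; case: ifPn => // _; rewrite exprn_ge0// ltW.
  (* The rate is also cutoff^(-alpha), so 2^l > cutoff yields r^l < rate and the second geometric
     sum applies. *)
  rewrite rl [X in _ <= _ + X]ifT; last first.
    rewrite (_ : rate alpha n = cutoff alpha n `^ (- alpha)); last first.
      by rewrite /cutoff -powRrM /rate; congr powR; field; rewrite gt_eqF.
    rewrite /r -powR_mulrn ?powR_ge0// -powRrM mulrC powRrM powR_mulrn//.
    rewrite !powRN ltf_pV2 ?posrE ?powR_gt0 ?exprn_gt0//.
    by rewrite gt0_ltr_powR ?nnegrE ?exprn_ge0 ?(ltW T0).
  rewrite lerDr mulr_ge0 ?sqrtr_ge0//; case: ifPn => // _.
  by rewrite exprn_ge0// (le_trans ler01 (ltW q1)).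
rewrite mulrDl -mulr_suml lerD//.
  apply: (@le_trans _ _ (S * q / (q - 1) * Num.sqrt eps)).
    by apply: ler_wpM2r; [exact: sqrtr_ge0 | exact: geometric_sum_below].
  by rewrite -Srate le_eqVlt; apply/orP; left; apply/eqP; ring.
by rewrite mulrC; apply: geometric_sum_above => //; exact: ltW.
Qed.

End geometric.

(** * Dominated series, integrals and inner products on [0,1] *)

Lemma dominated_series_cvg (R : realType) (u v : nat -> R) (s : R) :
  (forall m, \sum_(l < m) v l <= s) -> (forall l, `|u l| <= v l) ->
  cvgn (series u) /\ `|limn (series u)| <= s.
Proof.
move=> vs uv; have v0 l : 0 <= v l by exact: le_trans (uv l).
have cv : cvgn (series v).
  apply: nondecreasing_is_cvgn.
    by apply/nondecreasing_seqP => n; rewrite !seriesEord/= big_ord_recr/= lerDl.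
  by exists s => _ [m _ <-]; rewrite seriesEord/=; exact: vs.
have cu : cvgn [normed series u] by apply: series_le_cvg cv => // n; exact: normr_ge0.
split; first exact: normed_cvg.
apply: (le_trans (lim_series_norm cu)).
apply: limr_le => //; apply: nearW => m; rewrite /normed_series_of/= /series/= big_mkord.
by apply: le_trans (vs m); apply: ler_sum => l _; exact: uv.
Qed.

Section integrals01.
Variable R : realType.
Implicit Types f g : R -> R.

Lemma leb_I01 : leb (@I01 R) = 1%E.
Proof.
by rewrite /leb /I01 lebesgue_measure_itv/= lte_fin ltr01 oppr0 adde0.
Qed.

Lemma bounded_integrable01 f (M : R) : measurable_fun (@I01 R) f ->
  (forall t, t \in @I01 R -> `|f t| <= M) -> (@leb R).-integrable (@I01 R) (EFin \o f).
Proof.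
move=> mf fM; apply: measurable_bounded_integrable => //.
- exact: I01_meas.
- by rewrite [X in (X < _)%E]leb_I01 ltry.
exists M; split; first exact: num_real.
by move=> x Mx t It /=; apply: le_trans (ltW Mx); rewrite fM// inE.
Qed.

(** Domination by M (1 + f^2), integrable because [0,1] has finite measure. *)
Lemma L2_bounded_integrable01 f g (M : R) : L2_01 f -> measurable_fun (@I01 R) g ->
  (forall t, t \in @I01 R -> `|g t| <= M) ->
  (@leb R).-integrable (@I01 R) (EFin \o (fun t => f t * g t)).
Proof.
move=> [mf if2] mg gM.
have M0 : 0 <= M.
  apply: le_trans (gM 0 _); first exact: normr_ge0.
  by rewrite inE /I01/= in_itv/= lexx ler01.
have ig : (@leb R).-integrable (@I01 R)
    (fun t => (M%:E * ((EFin \o cst 1%R) t + (f t ^+ 2)%:E))%E).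
  apply: integrableZl; first exact: I01_meas.
  apply: integrableD; [exact: I01_meas| |exact: if2].
  by apply: (@bounded_integrable01 _ 1) => // t _; rewrite normr1.
apply: (le_integrable _ _ _ ig); first exact: I01_meas.
- by apply/measurable_EFinP; exact: measurable_funM.
- move=> t It /=; rewrite lee_fin.
  rewrite normrM [leRHS]ger0_norm; last by rewrite mulr_ge0// addr_ge0// sqr_ge0.
  rewrite mulrC; apply: ler_pM => //; first by rewrite gM// inE.
  rewrite -[X in _ <= 1 + X]real_normK ?num_real//.
  have := sqr_ge0 (`|f t| - 1); have := normr_ge0 (f t).
  by rewrite sqrrB1; set x := `|f t|; have := sqr_ge0 x; lra.
Qed.

End integrals01.

Section inner_product.
Variable R : realType.

(** Integrability is carried along because additivity of the integral needs it at each step of the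
    induction. *)
Lemma ip01_sum (I : Type) (s : seq I) (g : I -> R -> R) (h : R -> R) :
  (forall i, (@leb R).-integrable (@I01 R) (EFin \o (fun t => g i t * h t))) ->
  (@leb R).-integrable (@I01 R) (EFin \o (fun t => (\sum_(i <- s) g i t) * h t)) /\
  ip01 (fun t => \sum_(i <- s) g i t) h = \sum_(i <- s) ip01 (g i) h.
Proof.
move=> ig; elim: s => [|i s [ih1 ih2]].
  split.
    rewrite (_ : _ \o _ = cst 0%E); first exact: integrable0.
    by apply/funext => t /=; rewrite big_nil mul0r.
  rewrite big_nil /ip01; transitivity (Rintegral (@leb R) (@I01 R) (cst 0)).
    by apply: eq_Rintegral => t _ /=; rewrite big_nil mul0r.
  by rewrite Rintegral_cst ?mul0r//; exact: I01_meas.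
split.
  rewrite (_ : _ \o _ = ((EFin \o (fun t => (g i t * h t)%R)) \+
    (EFin \o (fun t => ((\sum_(i <- s) g i t) * h t)%R)))%E); last first.
    by apply/funext => t /=; rewrite big_cons mulrDl EFinD.
  by apply: integrableD => //; exact: I01_meas.
rewrite big_cons -ih2 /ip01 -RintegralD//; last exact: I01_meas.
by apply: eq_Rintegral => t _; rewrite big_cons mulrDl.
Qed.

Lemma ip01Zl (a : R) (g h : R -> R) :
  (@leb R).-integrable (@I01 R) (EFin \o (fun t => g t * h t)) ->
  (@leb R).-integrable (@I01 R) (EFin \o (fun t => (a * g t) * h t)) /\
  ip01 (fun t => a * g t) h = a * ip01 g h.
Proof.
move=> ig; split.
  rewrite (_ : _ \o _ = (fun t => a%:E * (EFin \o (fun t => (g t * h t)%R)) t)%E); last first.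
    by apply/funext => t /=; rewrite -mulrA EFinM.
  by apply: integrableZl => //; exact: I01_meas.
rewrite /ip01 -RintegralZl//; last exact: I01_meas.
by apply: eq_Rintegral => t _; rewrite mulrA.
Qed.

End inner_product.

Lemma ae_leb01 (R : realType) (A : set R) :
  (\forall t \ae @leb R, @I01 R t -> A t) -> \forall t \ae @leb01 R, A t.
Proof.
move=> [N [mN N0 sN]]; exists (N `|` ~` (@I01 R)); split.
- by apply: measurableU => //; apply: measurableC; exact: I01_meas.
- rewrite /leb01/= /mrestr setIUl setICl setU0.
  apply: (@subset_measure0 _ _ _ (@leb R) _ N) => //.
  by apply: measurableI => //; exact: I01_meas.
- move=> t /= nA; have [It|It] := pselect (@I01 R t); last by right.
  by left; apply: sN => /= /(_ It).
Qed.

(** * Reconstruction of f0 and the sup-norm bound *)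

Section wavelet.
Variables (R : realType) (alpha : R) (psi : nat -> nat -> R -> R) (f0 : R -> R).
Variables Cb Cs B : R.
Hypothesis alpha0 : 0 < alpha.
Hypothesis mpsi : forall l k, measurable_fun setT (psi l k).
Hypothesis psi_orth : forall l k l' k', (k < 2 ^ l)%N -> (k' < 2 ^ l')%N ->
  ip01 (psi l k) (psi l' k') = if (l == l') && (k == k') then 1 else 0.
Hypothesis psi_complete : forall g, L2_01 g ->
  (forall l k, (k < 2 ^ l)%N -> ip01 g (psi l k) = 0) ->
  Rintegral (@leb R) (@I01 R) (fun t => g t ^+ 2) = 0.
Hypothesis psi_bound : forall l k t, (k < 2 ^ l)%N -> t \in @I01 R ->
  `|psi l k t| <= Cb * Num.sqrt (2 ^+ l).
Hypothesis Cs0 : 0 < Cs.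
Hypothesis psi_sum : forall l t, t \in @I01 R ->
  \sum_(k < 2 ^ l) `|psi l k t| <= Cs * Num.sqrt (2 ^+ l).
Hypothesis f0L2 : L2_01 f0.
Let c l k := ip01 f0 (psi l k).
Hypothesis c_bound : forall l k, (k < 2 ^ l)%N -> `|c l k| <= B * coef_scale alpha l.
Hypothesis B0 : 0 <= B.

Let blk (d : nat -> nat -> R) l t := \sum_(k < 2 ^ l) d l k * psi l k t.

Lemma wavelet_seriesE d t : wavelet_series psi d t = limn (series (fun l => blk d l t)).
Proof.
rewrite (_ : series _ = fun L => \sum_(l < L) blk d l t)//.
by apply/funext => L; rewrite /series/= big_mkord.
Qed.

Lemma block_bound d l t (q : R) : 0 <= q -> (forall k, (k < 2 ^ l)%N -> `|d l k| <= q) ->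
  t \in @I01 R -> `|blk d l t| <= q * (Cs * Num.sqrt (2 ^+ l)).
Proof.
move=> q0 dq It; apply: (le_trans (ler_norm_sum _ _ _)).
apply: (@le_trans _ _ (\sum_(k < 2 ^ l) q * `|psi l k t|)).
  by apply: ler_sum => k _; rewrite normrM ler_wpM2r// dq.
by rewrite -mulr_sumr ler_wpM2l// psi_sum.
Qed.

Let r : R := 2 `^ (- alpha).
Let S0 : R := B * Cs * (2 / (1 - r)).

Let coef_sum m : \sum_(l < m) B * coef_scale alpha l * (Cs * Num.sqrt (2 ^+ l)) <= S0.
Proof.
(* The truncated sum is used with the level 2 so that its strict test always holds, including at l =
   0 where r^0 = 1; this is the 2 in [S0]. *)
have -> : \sum_(l < m) B * coef_scale alpha l * (Cs * Num.sqrt (2 ^+ l)) =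
    B * Cs * \sum_(l < m) (if r ^+ l < 2 then r ^+ l else 0).
  rewrite mulr_sumr; apply: eq_bigr => l _; rewrite ifT.
    by rewrite -sqrt_exp2_coef_scale; ring.
  by rewrite (@le_lt_trans _ _ 1) ?ltr1n// exprn_ile1 ?powR_ge0// ltW// powR2N_lt1.
apply: ler_wpM2l; first by rewrite mulr_ge0// ltW.
by apply: geometric_sum_above; rewrite ?powR_ge0// powR2N_lt1.
Qed.

Let cblk l t : t \in @I01 R -> `|blk c l t| <= B * coef_scale alpha l * (Cs * Num.sqrt (2 ^+ l)).
Proof.
move=> It; apply: block_bound => //; last exact: c_bound.
by rewrite mulr_ge0// powR_ge0.
Qed.

Let F := wavelet_series psi c.

Lemma coef_series_cvg t : t \in @I01 R -> series (fun l => blk c l t) @ \oo --> F t.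
Proof.
move=> It; rewrite /F wavelet_seriesE.
by have [] := dominated_series_cvg coef_sum (fun l => cblk l It).
Qed.

Let F_bound t : t \in @I01 R -> `|F t| <= S0.
Proof.
move=> It; rewrite /F wavelet_seriesE.
by have [] := dominated_series_cvg coef_sum (fun l => cblk l It).
Qed.

Let h m t := series (fun l => blk c l t) m.

Let h_bound m t : t \in @I01 R -> `|h m t| <= S0.
Proof.
move=> It; rewrite /h /series/= big_mkord; apply: le_trans (coef_sum m).
by apply: (le_trans (ler_norm_sum _ _ _)); apply: ler_sum => l _; exact: cblk.
Qed.

Let mh m : measurable_fun (@I01 R) (h m).
Proof.
apply: measurable_funTS; apply: measurable_sum => l.
by apply: measurable_sum => k; apply: measurable_funM.
Qed.

Let mF : measurable_fun (@I01 R) F.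
Proof.
by apply: (measurable_fun_cvg mh) => t It; apply: coef_series_cvg; rewrite inE.
Qed.

Let mpsi01 l k : measurable_fun (@I01 R) (psi l k).
Proof. exact: measurable_funTS. Qed.

Let ipsi l k l' k' : (k < 2 ^ l)%N -> (k' < 2 ^ l')%N ->
  (@leb R).-integrable (@I01 R) (EFin \o (fun t => psi l k t * psi l' k' t)).
Proof.
move=> kl kl'; apply: (@bounded_integrable01 _ _
   (Cb * Num.sqrt (2 ^+ l) * (Cb * Num.sqrt (2 ^+ l')))).
  exact: measurable_funM.
by move=> t It; rewrite normrM ler_pM// psi_bound.
Qed.

Let ip_partial m l k : (k < 2 ^ l)%N -> (l < m)%N -> ip01 (h m) (psi l k) = c l k.
Proof.
move=> kl lm.
have [ib ipb] : (forall l', (@leb R).-integrable (@I01 R)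
      (EFin \o (fun t => blk c l' t * psi l k t))) /\
    (forall l', ip01 (blk c l') (psi l k) = if l' == l then c l k else 0).
  have H l' := @ip01_sum R 'I_(2 ^ l') (index_enum 'I_(2 ^ l'))
    (fun k' t => c l' k' * psi l' k' t) (psi l k)
    (fun k' => proj1 (@ip01Zl R (c l' k') _ _ (@ipsi l' k' l k (ltn_ord k') kl))).
  split => l'; first exact: (H l').1.
  rewrite (H l').2.
  under eq_bigr => k' _.
    rewrite (@ip01Zl R (c l' k') _ _ (@ipsi l' k' l k (ltn_ord k') kl)).2.
    rewrite psi_orth//; over.
  have [->|ll'] := eqVneq l' l; last first.
    by rewrite big1// => k' _; rewrite mulr0.
  rewrite (bigD1 (Ordinal kl))//= eqxx mulr1 big1 ?addr0// => k' kk'.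
  by rewrite ifN ?mulr0//; apply: contra kk' => /eqP kE; apply/eqP/val_inj.
have := (@ip01_sum R nat (index_iota 0 m) (blk c) (psi l k) ib).2.
rewrite /h /series/= => ->.
rewrite (eq_bigr _ (fun i _ => ipb i)) big_mkord (bigD1 (Ordinal lm))//= eqxx.
by rewrite big1 ?addr0// => i il; rewrite ifN.
Qed.

(** By orthonormality the inner product of a partial sum with [psi l k] is constant once level l is
    included. The uniform bound [S0] lets dominated convergence pass to the limit. *)
Lemma ip01_coef_series l k : (k < 2 ^ l)%N -> ip01 F (psi l k) = c l k.
Proof.
move=> kl.
have mD := @I01_meas R.
pose M := S0 * (Cb * Num.sqrt (2 ^+ l)).
have mhp m : measurable_fun (@I01 R) (fun t => h m t * psi l k t).
  exact: measurable_funM.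
have ih m : (@leb R).-integrable (@I01 R) (EFin \o (fun t => h m t * psi l k t)).
  apply: (@bounded_integrable01 _ _ M); first exact: measurable_funM.
  by move=> t It; rewrite normrM ler_pM// ?h_bound// psi_bound.
have cv : (fun m => (\int[@leb R]_(t in @I01 R) (h m t * psi l k t)%:E)%E) @ \oo -->
    (\int[@leb R]_(t in @I01 R) (F t * psi l k t)%:E)%E.
  apply: (@dominated_cvg _ _ _ _ _ _ _ _ (EFin \o cst M)) => //.
  - by move=> m; apply/measurable_EFinP; exact: mhp.
  - move=> t It; apply: cvg_EFin; first exact: nearW.
    apply: cvgM; last exact: cvg_cst.
    by apply: coef_series_cvg; rewrite inE.
  - by apply: (@bounded_integrable01 _ _ `|M|).
  - move=> m t It /=; have It' : t \in @I01 R by rewrite inE.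
    by rewrite lee_fin normrM ler_pM// ?h_bound// psi_bound.
have cc : (fun m => (\int[@leb R]_(t in @I01 R) (h m t * psi l k t)%:E)%E) @ \oo -->
    (c l k)%:E.
  apply: cvg_near_cst; exists l.+1 => // m /= lm.
  rewrite -(ip_partial kl lm) /ip01 /Rintegral fineK//.
  by apply: integrable_fin_num; [exact: I01_meas | exact: ih].
rewrite /ip01 /Rintegral.
by rewrite -(cvg_lim _ cv)// (cvg_lim _ cc).
Qed.

(** [wavelet_series] is a pointwise limit while [f0] is only square integrable, so they must be
    identified: f0 - F is in L2 with all coefficients zero, and completeness makes it vanish almost
    everywhere. *)
Lemma coef_series_ae : \forall t \ae @leb01 R, F t = f0 t.
Proof.
have mD := @I01_meas R.
have [mf if2] := f0L2.
pose g t := f0 t - F t.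
have mg : measurable_fun (@I01 R) g by exact: measurable_funB.
have ig2 : (@leb R).-integrable (@I01 R) (fun t => (g t ^+ 2)%:E).
  have ib : (@leb R).-integrable (@I01 R)
      (fun t => (2%:E * ((f0 t ^+ 2)%:E + (EFin \o cst (S0 ^+ 2)%R) t))%E).
    apply: integrableZl => //; apply: integrableD => //.
    by apply: (@bounded_integrable01 _ _ `|S0 ^+ 2|) => // t _.
  apply: (le_integrable _ _ _ ib) => //.
    by apply/measurable_EFinP; exact: measurable_funX.
  move=> t It /=; rewrite lee_fin !ger0_norm ?sqr_ge0//; last first.
    by rewrite mulr_ge0// addr_ge0// sqr_ge0.
  have : F t ^+ 2 <= S0 ^+ 2.
    have FS : `|F t| <= S0 by apply: F_bound; rewrite inE.
    by rewrite -[leLHS]real_normK ?num_real// lerXn2r ?nnegrE// (le_trans _ FS).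
  rewrite /g; have := sqr_ge0 (f0 t + F t); lra.
have gL2 : L2_01 g by split.
have : Rintegral (@leb R) (@I01 R) (fun t => g t ^+ 2) = 0.
  apply: psi_complete => // l k kl.
  rewrite /ip01; transitivity (Rintegral (@leb R) (@I01 R)
      (fun t => f0 t * psi l k t - F t * psi l k t)).
    by apply: eq_Rintegral => t _; rewrite /g mulrBl.
  rewrite RintegralB//.
  - rewrite -/(ip01 f0 (psi l k)) -/(ip01 F (psi l k)) ip01_coef_series//.
    by rewrite /c subrr.
  - apply: (@L2_bounded_integrable01 _ _ _ (Cb * Num.sqrt (2 ^+ l))) => // t It.
    exact: psi_bound.
  - apply: (@bounded_integrable01 _ _ (S0 * (Cb * Num.sqrt (2 ^+ l)))).
      exact: measurable_funM.
    by move=> t It; rewrite normrM ler_pM// ?F_bound// psi_bound.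
move=> g2; have g20 : (\int[@leb R]_(t in @I01 R) (g t ^+ 2)%:E = 0)%E.
  rewrite -[LHS]fineK; first by congr EFin; exact: g2.
  by apply: integrable_fin_num; [exact: I01_meas | exact: ig2].
have /ae_leb01 : ae_eq (@leb R) (@I01 R) (fun t => (g t ^+ 2)%:E) (cst 0%E).
  apply/ae_eq_integral_abs => //; first by apply/measurable_EFinP; exact: measurable_funX.
  rewrite -g20; apply: eq_integral => t _ /=.
  by rewrite ger0_norm// sqr_ge0.
apply: filterS => t /= -[] /eqP; rewrite sqrf_eq0 subr_eq0 => /eqP.
by [].
Qed.

Lemma supnorm_wavelet (d : nat -> nat -> R) (Q : nat -> R) :
  (forall l k, (k < 2 ^ l)%N -> `|d l k - c l k| <= Q l) ->
  (supnorm01 (fun t => (wavelet_series psi d t - f0 t)%R) <=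
   \sum_(l <oo) (Q l * (Cs * Num.sqrt (2 ^+ l)))%:E)%E.
Proof.
move=> dQ.
pose v l := Q l * (Cs * Num.sqrt (2 ^+ l)).
have Q0 l : 0 <= Q l by apply: le_trans (dQ l 0%N _); rewrite ?expn_gt0.
have v0 l : 0 <= v l by rewrite mulr_ge0// mulr_ge0 ?sqrtr_ge0// ltW.
(* [limn] carries no information on a divergent sequence. If the majorant is infinite the bound is
   trivial; if finite, it forces the difference series to converge, hence also the series of [d]. *)
have [->|Sfin] := eqVneq (\sum_(l <oo) (v l)%:E)%E +oo%E; first exact: leey.
have Sge0 : (0 <= \sum_(l <oo) (v l)%:E)%E by apply: nneseries_ge0 => n _ _; rewrite lee_fin.
have Sf : (\sum_(l <oo) (v l)%:E)%E \is a fin_num.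
  by rewrite ge0_fin_numE// ltey.
rewrite -(fineK Sf); set s := fine _.
have vs m : \sum_(l < m) v l <= s.
  rewrite -lee_fin /s fineK// -sumEFin -(big_mkord xpredT (fun l => (v l)%:E)).
  by apply: nneseries_lim_ge => n _ _; rewrite lee_fin.
have aeI : \forall t \ae @leb01 R, @I01 R t by apply: ae_leb01; exact: nearW.
apply/ess_supP; near=> t.
have Ft : F t = f0 t by near: t; exact: coef_series_ae.
have It : @I01 R t by near: t; exact: aeI.
rewrite lee_fin -Ft /F !wavelet_seriesE.
have It' : t \in @I01 R by rewrite inE.
have ub l : `|blk (fun l k => d l k - c l k) l t| <= v l.
  by apply: block_bound => // k kl; exact: dQ.
have [cu us] := dominated_series_cvg vs ub.
have cc : cvgn (series (fun l => blk c l t)) by apply/cvg_ex; exists (F t); exact: coef_series_cvg.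
suff -> : limn (series (fun l => blk d l t)) =
   limn (series (fun l => blk (fun l k => d l k - c l k) l t)) +
   limn (series (fun l => blk c l t)) by rewrite addrK.
rewrite -limD//; congr (limn _); apply/funext => m /=.
rewrite !fctE /series/= -big_split/=; apply: eq_bigr => l _.
rewrite -big_split/=; apply: eq_bigr => k _.
by rewrite -mulrDl subrK.
Unshelve. all: by end_near. Qed.

End wavelet.

(** * Assembly over all levels *)

Theorem theorem1 (R : realType) (alpha : R) (psi : nat -> nat -> R -> R)
  (f0 : R -> R) (phi : R -> R) (delta : R) :
  0 < alpha ->
  wavelet_basis alpha psi ->
  besov_inf alpha psi f0 ->
  (* phi is a continuous probability density on R, positive on [-1,1] *)
  continuous phi ->
  (forall x, 0 <= phi x) ->
  (\int[@leb R]_x (phi x)%:E = 1)%E ->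
  (forall x : R, -1 <= x <= 1 -> 0 < phi x) ->
  (* tail condition with exponent 1 + delta *)
  0 < delta ->
  (exists b1 b2 c1 c2 : R, [/\ 0 < b1, 0 < b2, 0 < c1, 0 < c2 &
     forall x : R, 1 <= `|x| ->
       c1 * expR (- b1 * `|x| `^ (1 + delta)) <= phi x <=
       c2 * expR (- b2 * `|x| `^ (1 + delta))]) ->
  exists M : R, 0 < M /\
  forall n : nat, (2 <= n)%N ->
  forall (d : measure_display) (Omega : measurableType d)
         (P : probability Omega R) (X Theta : nat -> nat -> Omega -> R),
    (* observations and posterior draws are random variables *)
    (forall l k, measurable_fun setT (X l k)) ->
    (forall l k, measurable_fun setT (Theta l k)) ->
    (* (X_lk, Theta_lk): X_lk = f0_lk + n^{-1/2} eps_lk, and Theta_lk | X_lk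
       is distributed according to the posterior under the prior
       f_lk ~ sigma_l^{-1} phi(./sigma_l) *)
    (forall l k, (k < 2 ^ l)%N ->
       forall B : set (R * R), measurable B ->
       P ((fun w => (X l k w, Theta l k w)) @^-1` B) =
       (\int[(@leb R \x @leb R)%E]_(z in B)
          (joint_density n (ip01 f0 (psi l k))
             (scaled_density phi (sigma_l alpha delta l)) z)%:E)%E) ->
    (* independence across coefficients (product data law, product posterior) *)
    indep_pairs P (fun l k w => (X l k w, Theta l k w)) ->
    (\int[P]_w supnorm01 (fun t => (wavelet_series psi (fun l k => Theta l k w) t - f0 t)%R)
       <= (M * rate alpha n)%:E)%E.
Proof.
move=> alpha0 [mpsi [orth [compl [_ [[Cb [Cb0 psib]] [[Cs [Cs0 psis]] _]]]]]].
move=> [f0L2 [B0 hB0]] cphi phi0 phi1 phipos delta0 [b1 [b2 [c1 [c2 [b10 b20 c10 c20 tails]]]]].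
pose B := Num.max B0 0.
have B_ge0 : 0 <= B by rewrite le_max lexx orbT.
have cB l k : (k < 2 ^ l)%N -> `|ip01 f0 (psi l k)| <= B * coef_scale alpha l.
  move=> kl; rewrite /coef_scale powRN ler_pdivlMr ?powR_gt0// mulrC.
  by apply: (le_trans (hB0 _ _ kl)); rewrite le_max lexx.
have [c c0 phi_lb] := density_lower_bound cphi delta0 phipos b10 c10
  (fun x x1 => proj1 (andP (tails x x1))).
have [C C0 phi_ub] := density_tail_bound delta0 phi0 b20 c20
  (fun x x1 => proj2 (andP (tails x x1))).
have b0 : 0 < b2 / 2 by rewrite divr_gt0.
have [M M0 levelM] := level_posterior_bound alpha0 delta0 cphi phi0 phi1 b10 c0 b0 C0
  B_ge0 phi_lb phi_ub.
have [C' C'0 sumC'] := level_rate_sum alpha0.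
exists (Cs * M * C'); split; first by rewrite !mulr_gt0.
move=> n n2 d Omega P X Theta mX mTheta law _.
have n0 : (0 < n)%N by exact: leq_trans n2.
have [a ae'] := choice (fun l => levelM n l n2); have [e ae] := choice ae'.
pose h l k w := excess (a l) (ip01 f0 (psi l k)) (Theta l k w).
have h0 l k w : 0 <= h l k w by exact: excess_ge0.
pose Q l w := a l + \sum_(k < 2 ^ l) h l k w.
have a0 l : 0 <= a l by have [] := ae l.
have Q0 l w : 0 <= Q l w by rewrite addr_ge0// sumr_ge0.
have mh l k : measurable_fun setT (h l k).
  exact: (measurableT_comp (measurable_excess _ _)).
have mQ l : measurable_fun setT (Q l).
  by apply: measurable_funD => //; exact: measurable_sum.
pose v l := Cs * Num.sqrt (2 ^+ l).
have v0 l : 0 <= v l by rewrite mulr_ge0 ?sqrtr_ge0// ltW.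
apply: (@le_trans _ _ (\int[P]_w (\sum_(l <oo) (Q l w * v l)%:E))%E).
  (* Only the majorant is known to be measurable in [w], and its terms are nonnegative, so integral
     and sum can be exchanged afterwards. *)
  apply: le_integral_nomeas => w _.
    by apply: nneseries_ge0 => l _ _; rewrite lee_fin mulr_ge0.
  apply: (supnorm_wavelet alpha0 mpsi orth compl psib Cs0 psis f0L2 cB B_ge0).
  move=> l k kl; apply: (le_trans (le_excess (a l) _ _)).
  rewrite lerD2l (bigD1 (Ordinal kl))//= lerDl.
  by apply: sumr_ge0 => i _; exact: h0.
rewrite integral_nneseries//; last 2 first.
- by move=> l; apply/measurable_EFinP; exact: measurable_funM.
- by move=> l w _; rewrite lee_fin mulr_ge0.
have IQ l : (\int[P]_w (Q l w * v l)%:E <=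
    (Cs * M * (Num.sqrt (2 ^+ l) * level_rate alpha n l))%:E)%E.
  have [_ e0 pe ub] := ae l.
  under eq_integral do rewrite mulrC EFinM.
  rewrite ge0_integralZl_EFin//; last 2 first.
  - by move=> w _; rewrite lee_fin.
  - by apply/measurable_EFinP; exact: mQ.
  apply: (@le_trans _ _ ((v l)%:E * (M * level_rate alpha n l)%:E)%E); last first.
    by rewrite -EFinM lee_fin /v le_eqVlt; apply/orP; left; apply/eqP; ring.
  apply: lee_wpmul2l; first by rewrite lee_fin.
  apply: (@le_trans _ _ (a l + 2 ^+ l * e l)%:E); last by rewrite lee_fin.
  under eq_integral do rewrite EFinD.
  rewrite ge0_integralD//; last 3 first.
  - by move=> w _; rewrite lee_fin.
  - by move=> w _; rewrite lee_fin sumr_ge0.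
  - by apply/measurable_EFinP; exact: measurable_sum.
  rewrite EFinD; apply: leeD.
    by rewrite integral_cst//= probability_setT mule1.
  under eq_integral do rewrite -sumEFin.
  rewrite ge0_integral_sum//; last 2 first.
  - by move=> k; apply/measurable_EFinP; exact: mh.
  - by move=> k w _; rewrite lee_fin.
  apply: (@le_trans _ _ (\sum_(k < 2 ^ l) (e l)%:E)%E).
    apply: lee_sum => k _.
    apply: le_trans (pe _ (cB l k (ltn_ord k))).
    have := integral_excess_le alpha0 delta0 cphi phi0 phi1 c0 B_ge0 phi_lb
      (a l) n0 (cB l k (ltn_ord k)) (mX l k) (mTheta l k) (law l k (ltn_ord k)).
    exact.
  by rewrite sumEFin lee_fin sumr_const card_ord -natrX mulr_natl.
apply: lime_le.
  by apply: is_cvg_nneseries => l _ _; apply: integral_ge0 => w _; rewrite lee_fin mulr_ge0.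
apply: nearW => m; apply: (@le_trans _ _ (\sum_(0 <= l < m)
  (Cs * M * (Num.sqrt (2 ^+ l) * level_rate alpha n l))%:E)%E).
  by apply: lee_sum => l _; exact: IQ.
rewrite sumEFin lee_fin big_mkord -mulr_sumr -[leRHS]mulrA.
by apply: ler_wpM2l; [rewrite mulr_ge0 ?ltW | exact: sumC'].
Qed.
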